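(* Let $a$ be a strongly regular scale factor (extended evenly to negative arguments) such that either (i) $\dot a(0^+)=0$ and there is $\epsilon>0$ with $\ddot a(t)\ge0$ on $(0,\epsilon)$, or (ii) $\infty>\dot a(0^+)>0$, and such that $\left|\frac{\dddot a(t)a^2(t)}{\dot a^3(t)}\right|\le C$ for all $t>0$ and some constant $C>0$. Then $g_{\tau\tau}(\tau,\rho)$ is continuously differentiable on $D_{\mathrm{polar}}$, and if $k=0$, $g_{\theta\theta}(\tau,\rho)$ and $g_{\phi\phi}(\tau,\rho,\theta)$ are continuous on $D_{\mathrm{polar}}$ (with their values at $\rho=\rho_{\mathcal M_\tau}$ defined as limits as $t_0\to0$).
   Context: A function $a:[0,\infty)\to[0,\infty)$ is a regular scale factor if: (a) $a(0)=0$; (b) $a$ is increasing and continuous on $[0,\infty)$, twice continuously differentiable on $(0,\infty)$, with an inverse function on $[0,\infty)$; (c) $\frac{a(t)\ddot a(t)}{\dot a(t)^2}\le1$ for all $t>0$ (presupposing $\dot a(t)\ne0$). It is strongly regular if also $\frac{a\ddot a}{\dot a^2}\ge-K$ on $(0,\infty)$ for a constant $K\ge1$. $\dot a(0^+)=\lim_{t\to0^+}\dot a(t)$. Extend $a$ by $a(-t)=a(t)$. $S_1=\sin$, $S_0(\chi)=\chi$, $S_{-1}=\sinh$; $k\in\{-1,0,1\}$ is the curvature parameter. For $0<s<\tau$, $\chi_s(\tau)=\int_s^\tau\frac{1}{a(t)}\frac{a(\tau)}{\sqrt{a^2(\tau)-a^2(t)}}dt$. For $\tau>0$, $\rho_{\mathcal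 M_\tau}=\int_0^\tau\frac{a(t)}{\sqrt{a^2(\tau)-a^2(t)}}dt$; for $0<\rho<2\rho_{\mathcal M_\tau}$, $t_0(\tau,\rho)$ is the unique $t_0\in(-\tau,\tau)$ with $\rho=\int_{t_0}^\tau\frac{a(t)}{\sqrt{a^2(\tau)-a^2(t)}}dt$. Define $f(\tau,t_0)=\int_{t_0}^{\tau}\frac{\ddot a(t)}{\dot a(t)^2}\left(\frac{\sqrt{a^2(\tau)-a^2(t_0)}}{\sqrt{a^2(\tau)-a^2(t)}}-1\right)dt$ for $0\le t_0<\tau$, $f(\tau,t_0)=2f(\tau,0)-f(\tau,-t_0)$ for $-\tau<t_0<0$, and $g_{\tau\tau}(\tau,\rho)=-[1-\dot a(\tau)f(\tau,t_0(\tau,\rho))]^2$. Let $\rho_{\max}(\tau)=\inf\{\rho\in(0,2\rho_{\mathcal M_\tau}):g_{\tau\tau}(\tau,\rho)=0\}$ if nonempty, else $2\rho_{\mathcal M_\tau}$. $D_{\mathrm{polar}}=\{(\tau,\rho,\theta,\phi):\tau>0,\ 0<\rho<\rho_{\max}(\tau),\ \theta\in I_\pi,\ \phi\in I_{2\pi}\}$ with $I_\pi,I_{2\pi}$ open intervals of lengths $\pi,2\pi$. For $t_0=t_0(\tau,\rho)\ne0$: $g_{\theta\theta}(\tau,\rho)=a^2(t_0)S_k^2(\chi_{|t_0|}(\tau))$, $g_{\phi\phi}(\tau,\rho,\theta)=g_{\theta\theta}(\tau,\rho)\sin^2\theta$. These are the coefficients of the extended metric $ds^2=g_{\tau\tau}d\tau^2+d\rho^2+g_{\theta\theta}d\theta^2+g_{\phi\phi}d\phi^2$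 in Fermi polar coordinates. *)

(* Defs.v *)
From Stdlib Require Import Reals ZArith ClassicalEpsilon.
From Coquelicot Require Import Coquelicot.
Open Scope R_scope.

(* Derivatives of the scale factor (a : R -> R is the even extension). *)
Definition adot (a : R -> R) : R -> R := Derive a.
Definition addot (a : R -> R) : R -> R := Derive (Derive a).
Definition adddot (a : R -> R) : R -> R := Derive (Derive (Derive a)).

Definition regular_scale_factor (a : R -> R) : Prop :=
  (* (a) *) a 0 = 0 /\
  (* (b) increasing (strictly, as it is invertible) on [0,oo) *)
  (forall s t, 0 <= s -> s < t -> a s < a t) /\
  (* (b) inverse function on [0,oo): a maps [0,oo) onto [0,oo) *)
  (forall y, 0 <= y -> exists t, 0 <= t /\ a t = y) /\
  filterlim a (at_right 0) (locally (a 0)) /\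
  (forall t, 0 < t -> continuous a t) /\
  (forall t, 0 < t ->
     ex_derive a t /\ ex_derive (Derive a) t /\ continuous (Derive (Derive a)) t) /\
  (* (c) presupposition adot <> 0, and the inequality *)
  (forall t, 0 < t -> adot a t <> 0) /\
  (forall t, 0 < t -> a t * addot a t / (adot a t) ^ 2 <= 1).

Definition strongly_regular_scale_factor (a : R -> R) : Prop :=
  regular_scale_factor a /\
  exists K, 1 <= K /\ forall t, 0 < t -> - K <= a t * addot a t / (adot a t) ^ 2.

Definition iint (f : R -> R) (lo hi : R) : R :=
  RInt_gen f (at_right lo) (at_left hi).

Definition chi (a : R -> R) (s tau : R) : R :=
  iint (fun t => / a t * (a tau / sqrt (a tau ^ 2 - a t ^ 2))) s tau.

Definition rho_of (a : R -> R) (tau t0 : R) : R :=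
  iint (fun t => a t / sqrt (a tau ^ 2 - a t ^ 2)) t0 tau.

Definition rhoM (a : R -> R) (tau : R) : R := rho_of a tau 0.

(* t0(tau, rho): the (unique) t0 in (-tau,tau) with rho = rho_of a tau t0 *)
Definition t0fun (a : R -> R) (tau rho : R) : R :=
  epsilon (inhabits 0) (fun t0 => - tau < t0 < tau /\ rho = rho_of a tau t0).

Definition f_pos (a : R -> R) (tau t0 : R) : R :=
  iint (fun t => addot a t / (adot a t) ^ 2 *
                 (sqrt (a tau ^ 2 - a t0 ^ 2) / sqrt (a tau ^ 2 - a t ^ 2) - 1))
       t0 tau.

Definition ffun (a : R -> R) (tau t0 : R) : R :=
  if Rle_dec 0 t0 then f_pos a tau t0
  else 2 * f_pos a tau 0 - f_pos a tau (- t0).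

Definition gtautau (a : R -> R) (tau rho : R) : R :=
  - (1 - adot a tau * ffun a tau (t0fun a tau rho)) ^ 2.

Definition gtt_zeros (a : R -> R) (tau : R) : R -> Prop :=
  fun rho => 0 < rho < 2 * rhoM a tau /\ gtautau a tau rho = 0.

Definition rho_max (a : R -> R) (tau : R) : R :=
  match excluded_middle_informative (exists rho, gtt_zeros a tau rho) with
  | left _ => real (Glb_Rbar (gtt_zeros a tau))
  | right _ => 2 * rhoM a tau
  end.

(* (tau, rho)-part of D_polar (the angular factors are free open intervals) *)
Definition Dtr (a : R -> R) (tau rho : R) : Prop :=
  0 < tau /\ 0 < rho < rho_max a tau.

(* S_k, k in {-1,0,1} *)
Definition Sk (k : Z) (x : R) : R :=
  match k with
  | 1%Z => sin x
  | 0%Z => x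
  | _ => sinh x
  end.

(* g_thetatheta for t0 <> 0 *)
Definition gthth (k : Z) (a : R -> R) (tau rho : R) : R :=
  let t0 := t0fun a tau rho in a t0 ^ 2 * (Sk k (chi a (Rabs t0) tau)) ^ 2.

Definition cont_within2 (g : R -> R -> R) (D : R -> R -> Prop) (x y : R) : Prop :=
  forall eps, 0 < eps -> exists delta, 0 < delta /\
    forall x' y', D x' y' -> Rabs (x' - x) < delta -> Rabs (y' - y) < delta ->
      Rabs (g x' y' - g x y) < eps.

Definition cont_within3 (g : R -> R -> R -> R) (D : R -> R -> R -> Prop)
  (x y z : R) : Prop :=
  forall eps, 0 < eps -> exists delta, 0 < delta /\
    forall x' y' z', D x' y' z' -> Rabs (x' - x) < delta -> Rabs (y' - y) < delta ->
      Rabs (z' - z) < delta -> Rabs (g x' y' z' - g x y z) < eps.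

Definition C1_on2 (g : R -> R -> R) (D : R -> R -> Prop) : Prop :=
  exists dx dy : R -> R -> R,
    forall x y, D x y ->
      differentiable_pt_lim g x y (dx x y) (dy x y) /\
      cont_within2 dx D x y /\ cont_within2 dy D x y.

(* Main.v *)
(** With [A = a tau] and [u = sgn(t0) a(t0)], every improper integral becomes an
    expression in Abel-type integrals of [g v / sqrt (A^2 - v^2)] over [v] in [[0, u]],
    where [g] is the Hubble radius [p = a / adot] as a function of [v = a t], or its
    logarithmic slope [w = v dp/dv]; both extend continuously by [0] at [v = 0]. Integrating by parts removes
    the second derivative of [a] from [f]:
      [1 - adot f = adot Psi / A^2],
      [Psi = u p(u) + sqrt (A^2 - u^2) * int_u^A w(v) / sqrt (A^2 - v^2) dv] for [u >= 0].
    In the chart [(tau, u)] both [g_tautau] and [rho] are C^1 and the [u]-derivative of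
    [g_tautau] is a continuous multiple of that of [rho], although the latter vanishes at
    [u = 0]; this makes [g_tautau] a C^1 function of [(tau, rho)]. The bound on the third
    derivative enters only through [w] being locally Lipschitz on the positive axis, which is
    what makes the complete integral of [w] up to [A] continuously differentiable in [A].
    For [k = 0], another integration by parts writes [a(t0) chi] as
      [(p(u) sqrt (A^2 - u^2) + |u| int_|u|^A w(v) sqrt (A^2 - v^2) / v^2 dv) / A],
    which tends to [0] as [u -> 0] because [w(0) = 0]. *)

Require Import Defs.
From Stdlib Require Import Reals ZArith Lra Lia ClassicalEpsilon Ranalysis5.
From Coquelicot Require Import Coquelicot.
Open Scope R_scope.

(** The Hubble radius [p] vanishes at [u = 0], hence so does the [u]-derivative of [rho], and the
    implicit function theorem says nothing about [t0 (tau, rho)] across [rho = rhoM]. Two facts get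
    around this. First, [rho] is still strictly monotone in [u], which makes the inverse continuous.
    Second, the identity [|u| = p * adot] shows that the [u]-derivative of [g_tautau] carries the
    same factor [p / sqrt (A^2 - u^2)], and what remains after removing it is continuous at [u = 0]
    because [adot] has a finite limit at [0+]. The two cases of the hypothesis are there to give
    this limit together with [a / adot -> 0]. The second obstacle is that the third derivative
    exists and is controlled but need not be continuous, so the complete integral of [w] is not
    differentiated under the integral sign. It is a limit of integrals cut at a fixed angle below
    [PI / 2]; their [A]-derivatives fall on the kernel and on the limit of integration, never on
    [w], and the omitted tail only has to be Lipschitz in [A] with a small constant. *)

(** * Mean value estimates and differentiation through a degenerate chart *)

Lemma continuity_pt_of_is_derive (f : R -> R) (x l : R) :
  is_derive f x l -> continuity_pt f x.
Proof.
  intros H. apply continuity_pt_filterlim.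
  apply (ex_derive_continuous f x). now exists l.
Qed.

Lemma is_derive_estimate (f : R -> R) (x l e : R) :
  is_derive f x l -> 0 < e ->
  exists d, 0 < d /\ forall t, Rabs (t - x) < d ->
    Rabs (f t - f x - l * (t - x)) <= e * Rabs (t - x).
Proof.
  intros H He. apply is_derive_Reals in H.
  destruct (H e He) as [d Hd]. exists d. split; [apply cond_pos|].
  intros t Ht. destruct (Req_dec t x) as [->|Hne].
  - replace (f x - f x - l * (x - x)) with 0 by ring.
    rewrite Rminus_diag, !Rabs_R0. lra.
  - assert (Hh : t - x <> 0) by lra.
    specialize (Hd _ Hh Ht). replace (x + (t - x)) with t in Hd by ring.
    replace (f t - f x - l * (t - x)) with (((f t - f x) / (t - x) - l) * (t - x))
      by (field; auto).
    rewrite Rabs_mult. apply Rmult_le_compat_r; [apply Rabs_pos | lra].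
Qed.

Lemma is_derive_of_estimate (f : R -> R) (x l : R) :
  (forall e, 0 < e -> exists d, 0 < d /\ forall t, Rabs (t - x) < d ->
    Rabs (f t - f x - l * (t - x)) <= e * Rabs (t - x)) ->
  is_derive f x l.
Proof.
  intros H. apply is_derive_Reals. intros e He.
  destruct (H (e / 2)) as [d [Hd Hf]]; [lra|].
  exists (mkposreal d Hd). intros h Hh Hhd. simpl in Hhd.
  specialize (Hf (x + h)). replace (x + h - x) with h in Hf by ring.
  specialize (Hf Hhd).
  replace ((f (x + h) - f x) / h - l) with ((f (x + h) - f x - l * h) / h) by (field; auto).
  unfold Rdiv. rewrite Rabs_mult, Rabs_inv.
  assert (0 < Rabs h) by now apply Rabs_pos_lt.
  apply Rle_lt_trans with (e / 2 * Rabs h * / Rabs h).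
  - apply Rmult_le_compat_r; [left; now apply Rinv_0_lt_compat | exact Hf].
  - field_simplify; lra.
Qed.

Lemma antitone_of_derive (f df : R -> R) (x y : R) :
  x <= y -> (forall t, x <= t <= y -> is_derive f t (df t) /\ df t <= 0) -> f y <= f x.
Proof.
  intros Hxy H.
  destruct (MVT_gen f x y df) as [c [Hc E]]; rewrite ?Rmin_left, ?Rmax_right in * by lra.
  - intros t Ht. apply H. lra.
  - intros t Ht. eapply continuity_pt_of_is_derive. apply H. exact Ht.
  - assert (df c <= 0) by (apply H; lra). nra.
Qed.

Lemma lipschitz_of_derive (f df : R -> R) (M x y : R) :
  (forall t, Rmin x y <= t <= Rmax x y -> is_derive f t (df t) /\ Rabs (df t) <= M) ->
  Rabs (f y - f x) <= M * Rabs (y - x).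
Proof.
  intros H.
  destruct (MVT_gen f x y df) as [c [Hc E]].
  - intros t Ht. apply H. lra.
  - intros t Ht. eapply continuity_pt_of_is_derive. now apply H.
  - rewrite E, Rabs_mult. apply Rmult_le_compat_r; [apply Rabs_pos | now apply H].
Qed.

Lemma is_derive_bound_of_lipschitz (f : R -> R) (x l M d : R) :
  is_derive f x l -> 0 < d ->
  (forall t, Rabs (t - x) < d -> Rabs (f t - f x) <= M * Rabs (t - x)) ->
  Rabs l <= M.
Proof.
  intros Hf Hd HM. apply le_epsilon. intros e He.
  destruct (is_derive_estimate f x l e Hf He) as [d' [Hd' H]].
  set (h := Rmin d d' / 2).
  assert (Hh : 0 < h /\ h < d /\ h < d').
  { unfold h. pose proof (Rmin_l d d'). pose proof (Rmin_r d d').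
    assert (0 < Rmin d d') by now apply Rmin_glb_lt. lra. }
  assert (Hx : x + h - x = h) by ring.
  specialize (H (x + h)). specialize (HM (x + h)). rewrite Hx in *.
  rewrite (Rabs_right h) in * by lra.
  specialize (H ltac:(lra)). specialize (HM ltac:(lra)).
  assert (Rabs (l * h) <= (M + e) * h).
  { replace (l * h) with ((f (x + h) - f x) - (f (x + h) - f x - l * h)) by ring.
    eapply Rle_trans; [apply Rabs_triang|]. rewrite Rabs_Ropp. lra. }
  rewrite Rabs_mult, (Rabs_right h) in H0 by lra. nra.
Qed.

(** Meant for the time [t = 0], where [a] is only known to be continuous: by the mean value theorem
    the difference quotient at [x] is a value of [g] at a nearby point, and [g] is continuous at
    [x]. *)
Lemma is_derive_punctured (f g : R -> R) (x d : R) :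
  0 < d -> continuity_pt f x -> continuity_pt g x ->
  (forall t, 0 < Rabs (t - x) < d -> is_derive f t (g t)) ->
  is_derive f x (g x).
Proof.
  intros Hd Cf Cg H. apply is_derive_of_estimate. intros e He.
  destruct (Cg e He) as [d1 [Hd1 Hg]]. simpl in Hg. unfold Rdist in Hg.
  exists (Rmin d d1). split; [now apply Rmin_glb_lt|].
  intros t Ht.
  assert (Rabs (t - x) < d /\ Rabs (t - x) < d1)
    by (pose proof (Rmin_l d d1); pose proof (Rmin_r d d1); lra).
  destruct (MVT_gen f x t g) as [c [Hc E]].
  - intros s Hs. apply H. split; [|unfold Rmin, Rmax in Hs; destruct (Rle_dec x t)].
    + apply Rabs_pos_lt. unfold Rmin, Rmax in Hs; destruct (Rle_dec x t); lra.
    + rewrite Rabs_right in * by lra. lra.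
    + rewrite Rabs_left in * by lra. lra.
  - intros s Hs. destruct (Req_dec s x) as [->|Hn]; [exact Cf|].
    eapply continuity_pt_of_is_derive. apply H. split.
    + apply Rabs_pos_lt. lra.
    + unfold Rmin, Rmax in Hs; destruct (Rle_dec x t).
      * rewrite Rabs_right in * by lra. lra.
      * rewrite Rabs_left1 in * by lra. lra.
  - rewrite E. replace (g c * (t - x) - g x * (t - x)) with ((g c - g x) * (t - x)) by ring.
    rewrite Rabs_mult. apply Rmult_le_compat_r; [apply Rabs_pos|].
    destruct (Req_dec c x) as [->|Hn]; [rewrite Rminus_diag, Rabs_R0; lra|].
    left. apply Hg. split; [now split; auto|].
    assert (Rabs (c - x) <= Rabs (t - x)); [|lra].
    unfold Rmin, Rmax in Hc; destruct (Rle_dec x t).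
    + rewrite !Rabs_right by lra. lra.
    + rewrite !Rabs_left1 by lra. lra.
Qed.

Lemma continuity_2d_pt_comp2 (f g h : R -> R -> R) (x y : R) :
  continuity_2d_pt f (g x y) (h x y) ->
  continuity_2d_pt g x y -> continuity_2d_pt h x y ->
  continuity_2d_pt (fun u v => f (g u v) (h u v)) x y.
Proof.
  intros Hf Hg Hh eps. destruct (Hf eps) as [d Hd].
  generalize (locally_2d_and _ _ _ _ (Hg d) (Hh d)). apply locally_2d_impl.
  apply locally_2d_forall. intros u v [H1 H2]. now apply Hd.
Qed.

(* Moving [u] at fixed [t] changes [X] by [D] times the change of [P], even where
   [Pu] vanishes; hence no differentiability of the inverse [U] is needed. *)
Lemma differentiable_through_chart (X P D Pu U : R -> R -> R) (x r xl pl : R) :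
  locally_2d (fun t u => is_derive (X t) u (D t u * Pu t u) /\
                is_derive (P t) u (Pu t u) /\ Pu t u <= 0) x (U x r) ->
  continuity_2d_pt D x (U x r) ->
  is_derive (fun t => X t (U x r)) x xl ->
  is_derive (fun t => P t (U x r)) x pl ->
  locally_2d (fun t s => P t (U t s) = s) x r ->
  continuity_2d_pt U x r ->
  differentiable_pt_lim (fun t s => X t (U t s)) x r
    (xl - D x (U x r) * pl) (D x (U x r)).
Proof.
  intros [d1 H1] HD HX HP HPU HU eps.
  assert (HPx := locally_2d_singleton _ _ _ HPU). simpl in HPx.
  destruct HPU as [d2 H2].
  set (u0 := U x r) in *. set (D0 := D x u0) in *.
  (* [B] collects the coefficients of [e * m] in the final estimate: [2 + |pl|] from moving [u], [1]
     from moving [t] in [X], and [|D0|] from moving [t] in [P]. *)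
  set (B := 3 + Rabs pl + Rabs D0).
  assert (HB : 0 < B) by (unfold B; pose proof (Rabs_pos pl); pose proof (Rabs_pos D0); lra).
  set (e := Rmin 1 (eps / B)).
  assert (He : 0 < e).
  { apply Rmin_glb_lt; [lra|]. apply Rdiv_lt_0_compat; [apply cond_pos | exact HB]. }
  assert (He1 : e <= 1) by apply Rmin_l.
  assert (HeB : e * B <= eps).
  { replace (pos eps) with (eps / B * B) by (field; lra).
    apply Rmult_le_compat_r; [lra | apply Rmin_r]. }
  destruct (HD (mkposreal e He)) as [d3 H3]. simpl in H3.
  destruct (is_derive_estimate _ _ _ e HX He) as [d4 [Hd4 H4]].
  destruct (is_derive_estimate _ _ _ e HP He) as [d5 [Hd5 H5]].
  set (d6 := Rmin d1 d3).
  assert (Hd6 : 0 < d6) by (apply Rmin_glb_lt; apply cond_pos).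
  destruct (HU (mkposreal d6 Hd6)) as [d7 H7]. simpl in H7.
  set (dd := Rmin (Rmin (Rmin d1 d2) (Rmin d3 d4)) (Rmin d5 d7)).
  assert (Hdd : 0 < dd) by (repeat apply Rmin_glb_lt; try apply cond_pos; auto).
  exists (mkposreal dd Hdd). intros t s Ht Hs. simpl in Ht, Hs.
  assert (Hb : dd <= d1 /\ dd <= d2 /\ dd <= d3 /\ dd <= d4 /\ dd <= d5 /\ dd <= d7).
  { unfold dd, Rmin. repeat destruct Rle_dec; lra. }
  destruct Hb as (b1 & b2 & b3 & b4 & b5 & b7).
  specialize (H2 t s ltac:(lra) ltac:(lra)).
  specialize (H4 t ltac:(lra)). specialize (H5 t ltac:(lra)).
  specialize (H7 t s ltac:(lra) ltac:(lra)). fold u0 in H7.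
  set (u := U t s) in *.
  assert (Hd61 : d6 <= d1) by apply Rmin_l. assert (Hd63 : d6 <= d3) by apply Rmin_r.
  assert (K1 : forall v, Rabs (v - u0) <= Rabs (u - u0) ->
     is_derive (X t) v (D t v * Pu t v) /\ is_derive (P t) v (Pu t v) /\ Pu t v <= 0
     /\ Rabs (D t v - D0) <= e).
  { intros v Hv. destruct (H1 t v) as (Q1 & Q2 & Q3); try lra.
    split; [exact Q1|split; [exact Q2|split; [exact Q3|]]]. left. apply H3; lra. }
  (* This stands in for Cauchy's mean value theorem without dividing by [Pu]: the derivative is
     [(e + sg * (D - D0)) * Pu], a nonnegative factor times a nonpositive one. The two signs
     together bound the change of [X - D0 * P] by [e] times that of [P]. *)
  assert (Hmono : forall sg, (sg = 1 \/ sg = -1) ->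
     forall v w, v <= w ->
       (forall q, v <= q <= w -> Rabs (q - u0) <= Rabs (u - u0)) ->
       (e - sg * D0) * P t w + sg * X t w <= (e - sg * D0) * P t v + sg * X t v).
  { intros sg Hsg v w Hvw Hq.
    apply (antitone_of_derive (fun q => (e - sg * D0) * P t q + sg * X t q)
             (fun q => (e - sg * D0) * Pu t q + sg * (D t q * Pu t q)) v w Hvw).
    intros q Hq'. destruct (K1 q (Hq q Hq')) as (Q1 & Q2 & Q3 & Q4). split.
    - apply (is_derive_plus (fun q => (e - sg * D0) * P t q) (fun q => sg * X t q));
        now apply is_derive_scal.
    - apply Rabs_le_between in Q4. destruct Hsg; subst sg; nra. }
  assert (Hstep : Rabs (X t u - X t u0 - D0 * (P t u - P t u0)) <= e * Rabs (P t u - P t u0)).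
  { destruct (Rle_dec u0 u) as [Hu|Hu].
    - assert (Hq : forall q, u0 <= q <= u -> Rabs (q - u0) <= Rabs (u - u0))
        by (intros q Hq; rewrite !Rabs_right by lra; lra).
      pose proof (Hmono 1 (or_introl eq_refl) _ _ Hu Hq).
      pose proof (Hmono (-1) (or_intror eq_refl) _ _ Hu Hq).
      pose proof (Rle_abs (- (P t u - P t u0))) as A. rewrite Rabs_Ropp in A.
      apply Rabs_le. split; nra.
    - assert (Hu' : u <= u0) by lra.
      assert (Hq : forall q, u <= q <= u0 -> Rabs (q - u0) <= Rabs (u - u0))
        by (intros q Hq; rewrite !Rabs_left1 by lra; lra).
      pose proof (Hmono 1 (or_introl eq_refl) _ _ Hu' Hq).
      pose proof (Hmono (-1) (or_intror eq_refl) _ _ Hu' Hq).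
      pose proof (Rle_abs (P t u - P t u0)) as A.
      apply Rabs_le. split; nra. }
  set (m := Rmax (Rabs (t - x)) (Rabs (s - r))).
  assert (Hm1 : Rabs (t - x) <= m) by apply Rmax_l.
  assert (Hm2 : Rabs (s - r) <= m) by apply Rmax_r.
  assert (Hm0 : 0 <= m) by (pose proof (Rabs_pos (t - x)); lra).
  assert (HdP : Rabs (P t u - P t u0) <= (2 + Rabs pl) * m).
  { replace (P t u - P t u0) with
      ((s - r) - (P t u0 - P x u0 - pl * (t - x)) - pl * (t - x)) by (rewrite H2, HPx; ring).
    eapply Rle_trans; [apply Rabs_triang|]. rewrite Rabs_Ropp, Rabs_mult.
    assert (Rabs (s - r - (P t u0 - P x u0 - pl * (t - x))) <= 2 * m).
    { eapply Rle_trans; [apply Rabs_triang|]. rewrite Rabs_Ropp. nra. }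
    pose proof (Rabs_pos pl). nra. }
  (* The increment is split at the corner [(t, u0)]: first [u] moves at fixed [t], where only [P]
     measures the displacement, then [t] moves at fixed [u0]. The values of [P] at the two ends are
     [s] and [r]. *)
  replace (X t u - X x u0 - ((xl - D0 * pl) * (t - x) + D0 * (s - r))) with
    ((X t u - X t u0 - D0 * (P t u - P t u0)) + (X t u0 - X x u0 - xl * (t - x))
      + - (D0 * (P t u0 - P x u0 - pl * (t - x)))) by (rewrite H2, HPx; ring).
  eapply Rle_trans; [apply Rabs_triang|].
  eapply Rle_trans; [apply Rplus_le_compat_r, Rabs_triang|].
  rewrite Rabs_Ropp, Rabs_mult.
  apply Rle_trans with (e * ((2 + Rabs pl) * m) + e * m + Rabs D0 * (e * m)).
  - pose proof (Rabs_pos D0).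
    apply Rplus_le_compat; [apply Rplus_le_compat|].
    + eapply Rle_trans; [exact Hstep|]. apply Rmult_le_compat_l; lra.
    + nra.
    + apply Rmult_le_compat_l; [lra|]. nra.
  - replace (e * ((2 + Rabs pl) * m) + e * m + Rabs D0 * (e * m)) with (e * B * m)
      by (unfold B; ring).
    apply Rmult_le_compat_r; lra.
Qed.

(** * Continuity in two variables and integrals depending on a parameter *)

Lemma continuity_2d_pt_pow (f : R -> R -> R) (n : nat) (x y : R) :
  continuity_2d_pt f x y -> continuity_2d_pt (fun u v => f u v ^ n) x y.
Proof.
  intros H. apply (continuity_1d_2d_pt_comp (fun z => z ^ n)); auto.
  apply derivable_continuous_pt, derivable_pt_pow.
Qed.

Lemma continuity_pt_sqrt_all (x : R) : continuity_pt sqrt x.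
Proof. apply continuity_pt_filterlim, continuous_sqrt. Qed.

Ltac cont2 :=
  repeat first
   [ apply continuity_2d_pt_const | apply continuity_2d_pt_id1 | apply continuity_2d_pt_id2
   | assumption
   | apply continuity_2d_pt_plus | apply continuity_2d_pt_minus | apply continuity_2d_pt_opp
   | apply continuity_2d_pt_mult | apply continuity_2d_pt_inv | apply continuity_2d_pt_pow
   | apply (continuity_1d_2d_pt_comp sqrt); [apply continuity_pt_sqrt_all|]
   | apply (continuity_1d_2d_pt_comp Rabs); [apply Rcontinuity_abs|] ].

Lemma continuity_2d_pt_slice1 (f : R -> R -> R) (x y : R) :
  continuity_2d_pt f x y -> continuity_pt (fun t => f t y) x.
Proof.
  intros H e He. destruct (H (mkposreal e He)) as [d Hd].
  exists d. split; [apply cond_pos|]. intros t [_ Ht]. apply Hd; auto.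
  rewrite Rminus_diag, Rabs_R0. apply cond_pos.
Qed.

Lemma continuity_2d_pt_slice2 (f : R -> R -> R) (x y : R) :
  continuity_2d_pt f x y -> continuity_pt (f x) y.
Proof.
  intros H e He. destruct (H (mkposreal e He)) as [d Hd].
  exists d. split; [apply cond_pos|]. intros t [_ Ht]. apply Hd; auto.
  rewrite Rminus_diag, Rabs_R0. apply cond_pos.
Qed.

Lemma ex_RInt_of_continuity (f : R -> R) (x y : R) :
  (forall t, Rmin x y <= t <= Rmax x y -> continuity_pt f t) -> ex_RInt f x y.
Proof.
  intros H. apply (ex_RInt_continuous (V := R_CompleteNormedModule)).
  intros t Ht. apply continuity_pt_filterlim. now apply H.
Qed.

Lemma RInt_minus_R (f g : R -> R) (x y : R) : ex_RInt f x y -> ex_RInt g x y ->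
  RInt (fun t => f t - g t) x y = RInt f x y - RInt g x y.
Proof. exact (RInt_minus f g x y). Qed.

Lemma RInt_Chasles_R (f : R -> R) (x y z : R) : ex_RInt f x y -> ex_RInt f y z ->
  RInt f x y + RInt f y z = RInt f x z.
Proof. exact (RInt_Chasles f x y z). Qed.

Lemma abs_RInt_le (f : R -> R) (x y M : R) :
  (forall t, Rmin x y <= t <= Rmax x y -> continuity_pt f t) ->
  (forall t, Rmin x y <= t <= Rmax x y -> Rabs (f t) <= M) ->
  Rabs (RInt f x y) <= M * Rabs (y - x).
Proof.
  intros Hc HM. destruct (Rle_dec x y) as [H|H].
  - rewrite Rmin_left, Rmax_right in * by lra. rewrite (Rabs_right (y - x)) by lra.
    rewrite Rmult_comm. apply abs_RInt_le_const; auto.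
    apply ex_RInt_of_continuity. rewrite Rmin_left, Rmax_right by lra. auto.
  - rewrite Rmin_right, Rmax_left in * by lra. rewrite (Rabs_left (y - x)) by lra.
    assert (E : ex_RInt f y x).
    { apply ex_RInt_of_continuity. rewrite Rmin_left, Rmax_right by lra. auto. }
    rewrite <- (opp_RInt_swap f y x E). unfold opp; simpl. rewrite Rabs_Ropp.
    replace (M * - (y - x)) with ((x - y) * M) by ring.
    apply abs_RInt_le_const; auto. lra.
Qed.

Lemma is_derive_RInt_upper (f : R -> R) (al x lo hi : R) :
  lo < al < hi -> lo < x < hi ->
  (forall t, lo < t < hi -> continuity_pt f t) ->
  is_derive (RInt f al) x (f x).
Proof.
  intros Ha Hx Hc.
  apply (is_derive_RInt (V := R_NormedModule) f (RInt f al) al).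
  - assert (Hr : 0 < Rmin (x - lo) (hi - x)) by (apply Rmin_glb_lt; lra).
    exists (mkposreal _ Hr). intros y Hy.
    assert (Hy' : Rabs (y - x) < Rmin (x - lo) (hi - x)) by exact Hy.
    pose proof (Rmin_l (x - lo) (hi - x)). pose proof (Rmin_r (x - lo) (hi - x)).
    apply Rabs_def2 in Hy'.
    apply (RInt_correct (V := R_CompleteNormedModule)), ex_RInt_of_continuity.
    intros t Ht. apply Hc. unfold Rmin, Rmax in Ht. destruct (Rle_dec al y); lra.
  - apply continuity_pt_filterlim, Hc, Hx.
Qed.

(** The parameter moves over the fixed compact interval between [al] and [u0], where continuity is
    uniform; the upper limit moves over a short piece near [u0], where the integrand is bounded by
    [M]. *)
Lemma continuity_2d_pt_RInt (f : R -> R -> R) (al x0 u0 lo hi : R) :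
  lo < al < hi -> lo < u0 < hi ->
  locally x0 (fun x => forall v, lo < v < hi -> continuity_2d_pt f x v) ->
  continuity_2d_pt (fun x u => RInt (f x) al u) x0 u0.
Proof.
  intros Ha Hu [d0 H0] eps.
  assert (Hc : forall x v, Rabs (x - x0) < d0 -> lo < v < hi -> continuity_2d_pt f x v)
    by (intros x v Hx Hv; exact (H0 x Hx v Hv)). clear H0.
  assert (Hself : Rabs (x0 - x0) < d0) by (rewrite Rminus_diag, Rabs_R0; apply cond_pos).
  destruct (Hc x0 u0 Hself Hu (mkposreal 1 Rlt_0_1)) as [d1 H1]. simpl in H1.
  set (L := Rabs (u0 - al) + 1).
  assert (HL : 0 < L) by (unfold L; pose proof (Rabs_pos (u0 - al)); lra).
  assert (He1 : 0 < eps / 2 / L) by (repeat apply Rdiv_lt_0_compat; try lra; apply cond_pos).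
  destruct (uniform_continuity_2d_1d' f (Rmin al u0) (Rmax al u0) x0) with (eps := mkposreal _ He1)
    as [d2 H2].
  { intros v Hv. apply Hc; auto. unfold Rmin, Rmax in Hv. destruct (Rle_dec al u0); lra. }
  simpl in H2.
  set (M := Rabs (f x0 u0) + 1).
  assert (HM : 0 < M) by (unfold M; pose proof (Rabs_pos (f x0 u0)); lra).
  set (d := Rmin (Rmin (Rmin d0 d1) d2) (Rmin (eps / 2 / M) (Rmin (u0 - lo) (hi - u0)))).
  assert (Hd : 0 < d).
  { repeat apply Rmin_glb_lt; try apply cond_pos; try lra.
    repeat apply Rdiv_lt_0_compat; try lra; apply cond_pos. }
  assert (Hb : d <= d0 /\ d <= d1 /\ d <= d2 /\ d <= eps / 2 / M /\ d <= u0 - lo /\ d <= hi - u0).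
  { unfold d, Rmin. repeat destruct Rle_dec; lra. }
  destruct Hb as (b0 & b1 & b2 & b3 & b4 & b5).
  exists (mkposreal d Hd). simpl. intros x u Hx Huu.
  assert (Huu' := Huu). apply Rabs_def2 in Huu'.
  assert (C : forall v, lo < v < hi -> continuity_pt (f x) v)
    by (intros v Hv; apply (continuity_2d_pt_slice2 f), Hc; auto; lra).
  assert (C0 : forall v, lo < v < hi -> continuity_pt (f x0) v)
    by (intros v Hv; apply (continuity_2d_pt_slice2 f), Hc; auto; lra).
  assert (B1 : forall v, Rmin al u0 <= v <= Rmax al u0 -> lo < v < hi)
    by (intros v Hv; unfold Rmin, Rmax in Hv; destruct (Rle_dec al u0); lra).
  assert (B2 : forall v, Rmin u0 u <= v <= Rmax u0 u -> lo < v < hi /\ Rabs (v - u0) < d1).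
  { intros v Hv. split; [|apply Rabs_def1];
      unfold Rmin, Rmax in Hv; destruct (Rle_dec u0 u); lra. }
  assert (I1 : ex_RInt (f x) al u0) by (apply ex_RInt_of_continuity; auto).
  assert (I2 : ex_RInt (f x0) al u0) by (apply ex_RInt_of_continuity; auto).
  assert (I3 : ex_RInt (f x) u0 u)
    by (apply ex_RInt_of_continuity; intros v Hv; apply C, B2, Hv).
  rewrite <- (RInt_Chasles_R (f x) al u0 u I1 I3).
  replace (RInt (f x) al u0 + RInt (f x) u0 u - RInt (f x0) al u0)
    with (RInt (fun v => f x v - f x0 v) al u0 + RInt (f x) u0 u).
  2:{ rewrite (RInt_minus_R _ _ _ _ I1 I2). ring. }
  eapply Rle_lt_trans; [apply Rabs_triang|].
  assert (E1 : Rabs (RInt (fun v => f x v - f x0 v) al u0) <= eps / 2 / L * Rabs (u0 - al)).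
  { apply abs_RInt_le.
    - intros v Hv. apply continuity_pt_minus; auto.
    - intros v Hv. left. apply (H2 v x0 v x); auto; try (apply Rabs_def2 in Hx; lra).
      rewrite Rminus_diag, Rabs_R0. apply cond_pos. }
  assert (E2 : Rabs (RInt (f x) u0 u) <= M * Rabs (u - u0)).
  { apply abs_RInt_le.
    - intros v Hv. apply C, B2, Hv.
    - intros v Hv. specialize (H1 x v ltac:(lra) (proj2 (B2 v Hv))).
      unfold M. replace (f x v) with (f x0 u0 + (f x v - f x0 u0)) by ring.
      eapply Rle_trans; [apply Rabs_triang|]. lra. }
  assert (E3 : eps / 2 / L * Rabs (u0 - al) <= eps / 2).
  { replace (eps / 2) with (eps / 2 / L * L) at 2 by (field; lra).
    apply Rmult_le_compat_l; [lra|]. unfold L. lra. }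
  assert (E4 : M * Rabs (u - u0) < eps / 2).
  { replace (eps / 2) with (M * (eps / 2 / M)) by (field; lra).
    apply Rmult_lt_compat_l; lra. }
  lra.
Qed.

Lemma sq_lt_of_abs (A v : R) : Rabs v < A -> 0 < A ^ 2 - v ^ 2.
Proof. intros H. apply Rabs_def2 in H. nra. Qed.

(** * Abel-type integrals *)

(* [A] stands for [a(tau)] and [u] for [sgn(t0) a(t0)]; [abel_full g A] is the value of
   [abel g A u] at [u = A], desingularized by [v = A sin th]. *)
Definition abel (g : R -> R) (A u : R) : R := RInt (fun v => g v / sqrt (A ^ 2 - v ^ 2)) 0 u.
Definition abel_dA (g : R -> R) (A u : R) : R :=
  RInt (fun v => - (A * g v) / sqrt (A ^ 2 - v ^ 2) ^ 3) 0 u.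
Definition abel_full (g : R -> R) (A : R) : R := RInt (fun th => g (A * sin th)) 0 (PI / 2).

Lemma sqrt_gap_pos (A v : R) : Rabs v < A -> 0 < sqrt (A ^ 2 - v ^ 2).
Proof. intros H. now apply sqrt_lt_R0, sq_lt_of_abs. Qed.

Section Kernel.
Variable g : R -> R.
Hypothesis g_cont : forall u, continuity_pt g u.

Lemma continuity_2d_pt_kernel (A v : R) : Rabs v < A ->
  continuity_2d_pt (fun A v => g v / sqrt (A ^ 2 - v ^ 2)) A v.
Proof.
  intros H. pose proof (sqrt_gap_pos A v H). unfold Rdiv. cont2; [|lra].
  apply (continuity_1d_2d_pt_comp g (fun _ v => v)); cont2. apply g_cont.
Qed.

Lemma continuity_2d_pt_kernel_deriv (A v : R) : Rabs v < A ->
  continuity_2d_pt (fun A v => - (A * g v) / sqrt (A ^ 2 - v ^ 2) ^ 3) A v.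
Proof.
  intros H. pose proof (sqrt_gap_pos A v H). unfold Rdiv. cont2.
  2:{ apply pow_nonzero. lra. }
  apply (continuity_1d_2d_pt_comp g (fun _ v => v)); cont2. apply g_cont.
Qed.

(** Keeps the singularity [|v| = A'] of the kernel away from one interval [(-m, m)] containing [u],
    simultaneously for all [A'] near [A]. *)
Lemma locally_gap (A u : R) : Rabs u < A ->
  exists m, Rabs u < m < A /\ locally A (fun A' => m < A').
Proof.
  intros H. exists ((Rabs u + A) / 2). split; [lra|].
  assert (Hd : 0 < (A - Rabs u) / 2) by lra.
  exists (mkposreal _ Hd). intros y Hy. apply Rabs_def2 in Hy. simpl in Hy.
  unfold minus, plus, opp in Hy; simpl in Hy. lra.
Qed.

Lemma continuity_2d_pt_abel (A u : R) : Rabs u < A -> continuity_2d_pt (abel g) A u.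
Proof.
  intros H. destruct (locally_gap A u H) as [m [Hm L]].
  assert (0 <= Rabs u) by apply Rabs_pos.
  assert (Hu : - m < u < m) by (assert (Q : Rabs u < m) by lra; apply Rabs_def2 in Q; lra).
  apply (continuity_2d_pt_RInt (fun A v => g v / sqrt (A ^ 2 - v ^ 2)) 0 A u (- m) m); try lra.
  revert L. apply filter_imp. intros A' HA v Hv. apply continuity_2d_pt_kernel.
  apply Rabs_def1; lra.
Qed.

Lemma continuity_2d_pt_abel_dA (A u : R) : Rabs u < A -> continuity_2d_pt (abel_dA g) A u.
Proof.
  intros H. destruct (locally_gap A u H) as [m [Hm L]].
  assert (0 <= Rabs u) by apply Rabs_pos.
  assert (Hu : - m < u < m) by (assert (Q : Rabs u < m) by lra; apply Rabs_def2 in Q; lra).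
  apply (continuity_2d_pt_RInt (fun A v => - (A * g v) / sqrt (A ^ 2 - v ^ 2) ^ 3) 0 A u (- m) m);
    try lra.
  revert L. apply filter_imp. intros A' HA v Hv. apply continuity_2d_pt_kernel_deriv.
  apply Rabs_def1; lra.
Qed.

Lemma is_derive_abel_u (A u : R) : Rabs u < A ->
  is_derive (abel g A) u (g u / sqrt (A ^ 2 - u ^ 2)).
Proof.
  intros H. pose proof (Rabs_pos u). assert (Hu := Rabs_def2 _ _ H).
  apply (is_derive_RInt_upper (fun v => g v / sqrt (A ^ 2 - v ^ 2)) 0 u (- A) A); try lra.
  intros t Ht. apply (continuity_2d_pt_slice2 (fun A v => g v / sqrt (A ^ 2 - v ^ 2))).
  apply continuity_2d_pt_kernel. apply Rabs_def1; lra.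
Qed.

Lemma is_derive_kernel_A (A v : R) : Rabs v < A ->
  is_derive (fun A => g v / sqrt (A ^ 2 - v ^ 2)) A (- (A * g v) / sqrt (A ^ 2 - v ^ 2) ^ 3).
Proof.
  intros H. pose proof (sqrt_gap_pos A v H) as Hs. pose proof (sq_lt_of_abs A v H) as Hp.
  auto_derive; replace (A * (A * 1) + - (v * (v * 1))) with (A ^ 2 - v ^ 2) by ring.
  - repeat split; auto. lra.
  - field. lra.
Qed.

Lemma is_derive_abel_A (A u : R) : Rabs u < A ->
  is_derive (fun A => abel g A u) A (abel_dA g A u).
Proof.
  intros H. destruct (locally_gap A u H) as [m [Hm L]].
  pose proof (Rabs_pos u) as H0.
  assert (Hu : forall v, Rmin 0 u <= v <= Rmax 0 u -> Rabs v < m).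
  { intros v Hv. apply Rle_lt_trans with (Rabs u); [|lra].
    unfold Rmin, Rmax in Hv. destruct (Rle_dec 0 u).
    - rewrite !Rabs_right by lra. lra.
    - rewrite !Rabs_left1 by lra. lra. }
  replace (abel_dA g A u) with
    (RInt (fun v => Derive (fun A => g v / sqrt (A ^ 2 - v ^ 2)) A) 0 u).
  2:{ apply RInt_ext. intros v Hv. apply is_derive_unique, is_derive_kernel_A.
      assert (Rabs v < m) by (apply Hu; lra). lra. }
  apply (is_derive_RInt_param (fun A v => g v / sqrt (A ^ 2 - v ^ 2)) 0 u A).
  - revert L. apply filter_imp. intros A' HA v Hv.
    eexists. apply is_derive_kernel_A. specialize (Hu v Hv). lra.
  - intros v Hv. apply continuity_2d_pt_ext_loc with
      (f := fun A v => - (A * g v) / sqrt (A ^ 2 - v ^ 2) ^ 3).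
    + assert (HvA : Rabs v < A) by (specialize (Hu v Hv); lra).
      assert (Hd : 0 < (A - Rabs v) / 2) by lra.
      exists (mkposreal _ Hd). intros A' v' H1 H2. simpl in H1, H2. symmetry.
      apply is_derive_unique, is_derive_kernel_A.
      apply Rabs_def2 in H1. pose proof (Rabs_triang (v' - v) v).
      replace (v' - v + v) with v' in H3 by ring. lra.
    + apply continuity_2d_pt_kernel_deriv. specialize (Hu v Hv). lra.
  - revert L. apply filter_imp. intros A' HA. apply ex_RInt_of_continuity.
    intros v Hv. apply (continuity_2d_pt_slice2 (fun A v => g v / sqrt (A ^ 2 - v ^ 2))).
    apply continuity_2d_pt_kernel. specialize (Hu v Hv). lra.
Qed.

Lemma abel_0 (A : R) : abel g A 0 = 0.
Proof. apply (RInt_point (V := R_CompleteNormedModule)). Qed.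

Lemma abel_opp (A u : R) : (forall v, g (- v) = g v) -> Rabs u < A -> abel g A (- u) = - abel g A u.
Proof.
  intros Hev H. unfold abel. set (f := fun v => g v / sqrt (A ^ 2 - v ^ 2)).
  assert (I : ex_RInt f 0 (- u)).
  { apply ex_RInt_of_continuity. intros t Ht.
    apply (continuity_2d_pt_slice2 (fun A v => g v / sqrt (A ^ 2 - v ^ 2))).
    apply continuity_2d_pt_kernel. apply Rabs_def2 in H.
    apply Rabs_def1; unfold Rmin, Rmax in Ht; destruct (Rle_dec 0 (- u)); lra. }
  pose proof (RInt_comp_lin (V := R_CompleteNormedModule) f (-1) 0 0 u) as E.
  replace (-1 * 0 + 0) with 0 in E by ring. replace (-1 * u + 0) with (- u) in E by ring.
  rewrite <- (E I).
  assert (I' : ex_RInt f 0 u).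
  { apply ex_RInt_of_continuity. intros t Ht.
    apply (continuity_2d_pt_slice2 (fun A v => g v / sqrt (A ^ 2 - v ^ 2))).
    apply continuity_2d_pt_kernel. apply Rabs_def2 in H.
    apply Rabs_def1; unfold Rmin, Rmax in Ht; destruct (Rle_dec 0 u); lra. }
  etransitivity; [|exact (RInt_opp f 0 u I')].
  apply RInt_ext. intros x _. change (-1 * f (-1 * x + 0) = - f x). unfold f.
  replace (-1 * x + 0) with (- x) by ring. rewrite Hev.
  replace ((- x) ^ 2) with (x ^ 2) by ring. ring.
Qed.

Lemma continuity_pt_theta (A th : R) : continuity_pt (fun th => g (A * sin th)) th.
Proof.
  apply (continuity_pt_comp (fun th => A * sin th) g); [|apply g_cont].
  apply continuity_pt_mult; [apply continuity_pt_const; intros x y; reflexivity|].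
  apply continuity_sin.
Qed.

(** Under [v = A sin x] the square root becomes [A cos x] and cancels against the differential. The
    right side stays regular up to [th = PI / 2], which is what links [abel] to [abel_full]. *)
Lemma abel_sin (A th : R) : 0 < A -> - (PI / 2) < th < PI / 2 ->
  abel g A (A * sin th) = RInt (fun th => g (A * sin th)) 0 th.
Proof.
  intros HA Hth.
  assert (Hb : forall x, Rmin 0 th <= x <= Rmax 0 th -> - (PI / 2) < x < PI / 2).
  { intros x Hx. pose proof PI_RGT_0. unfold Rmin, Rmax in Hx. destruct (Rle_dec 0 th); lra. }
  assert (Hs : forall x, - (PI / 2) < x < PI / 2 -> Rabs (A * sin x) < A).
  { intros x Hx. assert (0 < cos x) by (apply cos_gt_0; lra).
    assert (sin x ^ 2 + cos x ^ 2 = 1) by (rewrite <- !Rsqr_pow2; apply sin2_cos2).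
    assert (-1 < sin x < 1) by nra. apply Rabs_def1; nra. }
  transitivity (RInt (fun x => scal (A * cos x) (g (A * sin x) / sqrt (A ^ 2 - (A * sin x) ^ 2))) 0 th).
  - symmetry. etransitivity; [apply (RInt_comp (V := R_CompleteNormedModule)
      (fun v => g v / sqrt (A ^ 2 - v ^ 2)) (fun x => A * sin x) (fun x => A * cos x) 0 th)|].
    + intros x Hx. apply continuity_pt_filterlim.
      apply (continuity_2d_pt_slice2 (fun A v => g v / sqrt (A ^ 2 - v ^ 2))).
      apply continuity_2d_pt_kernel, Hs, Hb, Hx.
    + intros x Hx. split; [auto_derive; auto; ring|].
      apply continuity_pt_filterlim. apply continuity_pt_mult; [|apply continuity_cos].
      apply continuity_pt_const; intros y z; reflexivity.
    + unfold abel. now rewrite sin_0, Rmult_0_r.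
  - apply RInt_ext. intros x Hx. assert (Hx' := Hb x ltac:(lra)).
    assert (0 < cos x) by (apply cos_gt_0; lra).
    assert (sin x ^ 2 + cos x ^ 2 = 1) by (rewrite <- !Rsqr_pow2; apply sin2_cos2).
    replace (A ^ 2 - (A * sin x) ^ 2) with ((A * cos x) ^ 2) by nra.
    rewrite sqrt_pow2 by nra.
    change (A * cos x * (g (A * sin x) / (A * cos x)) = g (A * sin x)). field. split; lra.
Qed.

End Kernel.

(** * Continuous differentiability of the complete integral *)

Lemma div_succ_small (M e : R) : 0 <= M -> 0 < e ->
  exists N, forall n, (N <= n)%nat -> M / (INR n + 1) < e.
Proof.
  intros HM He. destruct (INR_unbounded (M / e)) as [N HN]. exists N.
  intros n Hn. apply le_INR in Hn. pose proof (pos_INR n).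
  apply Rmult_lt_reg_r with (INR n + 1); [lra|].
  replace (M / (INR n + 1) * (INR n + 1)) with M by (field; lra).
  replace M with (e * (M / e)) by (field; lra).
  apply Rmult_lt_compat_l; lra.
Qed.

(** Differentiability of [F] is a conclusion here. Since [F - f n] is locally Lipschitz with
    constant [M / (n + 1)], the derivatives [d n] are locally uniformly Cauchy; their limit is
    continuous and, by an [e / 3] argument, is the derivative of [F]. *)
Lemma C1_of_lipschitz_approx (F : R -> R) (f d : nat -> R -> R) (dom : R -> Prop) :
  (forall n x, dom x -> is_derive (f n) x (d n x) /\ continuity_pt (d n) x) ->
  (forall x, dom x -> exists r M N, 0 < r /\ 0 <= M /\
     (forall y, Rabs (y - x) < r -> dom y) /\
     (forall n y z, (N <= n)%nat -> Rabs (y - x) < r -> Rabs (z - x) < r ->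
        Rabs ((F y - f n y) - (F z - f n z)) <= M / (INR n + 1) * Rabs (y - z))) ->
  exists dF, forall x, dom x -> is_derive F x (dF x) /\ continuity_pt dF x.
Proof.
  intros Hd HL. set (dF := fun x => real (Lim_seq (fun n => d n x))). exists dF.
  intros x0 Hx0. destruct (HL x0 Hx0) as (r & M & N & Hr & HM & Hdom & HLip).
  (* Writing [f n - f m] as the difference of the two errors makes it Lipschitz with the sum of
     their constants, and a local Lipschitz constant bounds the derivative. *)
  assert (Cau : forall x n m, Rabs (x - x0) < r -> (N <= n)%nat -> (N <= m)%nat ->
    Rabs (d n x - d m x) <= M / (INR n + 1) + M / (INR m + 1)).
  { intros x n m Hx Hn Hm. set (r' := r - Rabs (x - x0)).
    apply (is_derive_bound_of_lipschitz (fun t => f n t - f m t) x _ _ r').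
    - apply (is_derive_minus (f n) (f m)); now apply Hd, Hdom.
    - unfold r'; lra.
    - intros t Ht.
      assert (Ht' : Rabs (t - x0) < r).
      { replace (t - x0) with ((t - x) + (x - x0)) by ring.
        eapply Rle_lt_trans; [apply Rabs_triang|]. unfold r' in Ht. lra. }
      replace (f n t - f m t - (f n x - f m x)) with
        (((F t - f m t) - (F x - f m x)) - ((F t - f n t) - (F x - f n x))) by ring.
      eapply Rle_trans; [apply Rabs_triang|]. rewrite Rabs_Ropp.
      pose proof (HLip n t x Hn Ht' Hx). pose proof (HLip m t x Hm Ht' Hx). lra. }
  assert (Lim : forall x n, Rabs (x - x0) < r -> (N <= n)%nat ->
    Rabs (d n x - dF x) <= M / (INR n + 1)).
  { intros x n Hx Hn.
    assert (E : ex_finite_lim_seq (fun n => d n x)).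
    { apply ex_lim_seq_cauchy_corr. intros e.
      destruct (div_succ_small M (e / 2) HM) as [N1 HN1]; [apply is_pos_div_2|].
      exists (max N N1). intros p q Hp Hq.
      eapply Rle_lt_trans; [apply Cau; auto; lia|].
      pose proof (HN1 p ltac:(lia)). pose proof (HN1 q ltac:(lia)). lra. }
    apply Lim_seq_correct' in E. fold (dF x) in E. apply is_lim_seq_spec in E.
    apply le_epsilon. intros e He.
    assert (He2 : 0 < e / 2) by lra.
    destruct (E (mkposreal _ He2)) as [N2 HN2].
    destruct (div_succ_small M (e / 2) HM He2) as [N1 HN1].
    set (m := max N (max N1 N2)).
    specialize (HN2 m ltac:(lia)). simpl in HN2. specialize (HN1 m ltac:(lia)).
    specialize (Cau x n m Hx Hn ltac:(lia)).
    replace (d n x - dF x) with ((d n x - d m x) + (d m x - dF x)) by ring.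
    eapply Rle_trans; [apply Rabs_triang|]. lra. }
  assert (H0 : Rabs (x0 - x0) < r) by (rewrite Rminus_diag, Rabs_R0; lra).
  split.
  - apply is_derive_of_estimate. intros e He.
    assert (He3 : 0 < e / 3) by lra.
    destruct (div_succ_small M (e / 3) HM He3) as [N1 HN1].
    set (n := max N N1). specialize (HN1 n ltac:(lia)).
    destruct (is_derive_estimate (f n) x0 (d n x0) (e / 3)) as [d1 [Hd1 H1]];
      [now apply Hd | lra |].
    exists (Rmin r d1). split; [now apply Rmin_glb_lt|]. intros t Ht.
    assert (Rabs (t - x0) < r /\ Rabs (t - x0) < d1) as [Ht1 Ht2]
      by (pose proof (Rmin_l r d1); pose proof (Rmin_r r d1); lra).
    replace (F t - F x0 - dF x0 * (t - x0)) with
      (((F t - f n t) - (F x0 - f n x0)) + (f n t - f n x0 - d n x0 * (t - x0))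
        + (d n x0 - dF x0) * (t - x0)) by ring.
    eapply Rle_trans; [apply Rabs_triang|].
    eapply Rle_trans; [apply Rplus_le_compat_r, Rabs_triang|].
    rewrite (Rabs_mult (d n x0 - dF x0)).
    specialize (H1 t Ht2). specialize (HLip n t x0 ltac:(lia) Ht1 H0).
    specialize (Lim x0 n H0 ltac:(lia)). pose proof (Rabs_pos (t - x0)). nra.
  - intros e He. assert (He3 : 0 < e / 3) by lra.
    destruct (div_succ_small M (e / 3) HM He3) as [N1 HN1].
    set (n := max N N1). specialize (HN1 n ltac:(lia)).
    destruct (proj2 (Hd n x0 Hx0) (e / 3) He3) as [d1 [Hd1 H1]].
    exists (Rmin r d1). split; [now apply Rmin_glb_lt|]. intros t [Ht Htd].
    specialize (H1 t). simpl in *. unfold Rdist in *.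
    assert (Rabs (t - x0) < r /\ Rabs (t - x0) < d1) as [Ht1 Ht2]
      by (pose proof (Rmin_l r d1); pose proof (Rmin_r r d1); lra).
    specialize (H1 (conj Ht Ht2)).
    pose proof (Lim x0 n H0 ltac:(lia)). pose proof (Lim t n Ht1 ltac:(lia)).
    replace (dF t - dF x0) with (- (d n t - dF t) + (d n t - d n x0) + (d n x0 - dF x0)) by ring.
    eapply Rle_lt_trans; [apply Rabs_triang|].
    eapply Rle_lt_trans; [apply Rplus_le_compat_r, Rabs_triang|].
    rewrite Rabs_Ropp. lra.
Qed.

(** Restricted to positive base points because passing from [t] to [v = a t] divides slopes by
    [adot], which may tend to [0] at the origin. *)
Definition locally_lipschitz_on_pos (g : R -> R) : Prop :=
  forall A, 0 < A -> exists r M, 0 < r /\ 0 <= M /\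
    forall x y, Rabs (x - A) < r -> Rabs (y - A) < r -> Rabs (g x - g y) <= M * Rabs (x - y).

Section EndpointValue.
Variable g : R -> R.
Hypothesis g_cont : forall u, continuity_pt g u.

Lemma is_derive_theta_integral (A th : R) :
  is_derive (RInt (fun th => g (A * sin th)) 0) th (g (A * sin th)).
Proof.
  pose proof (Rabs_pos th).
  assert (Hth : Rabs th < Rabs th + 1) by lra. apply Rabs_def2 in Hth.
  apply (is_derive_RInt_upper (fun th => g (A * sin th)) 0 th (- (Rabs th + 1)) (Rabs th + 1));
    try lra.
  intros t _. now apply continuity_pt_theta.
Qed.

(** By [abel_sin] this is continuity of the angular integral at [PI / 2]. It justifies reading
    [abel_full] as the value at [u = A] and later supplies the upper endpoints of the improper
    integrals. *)
Lemma abel_near_full (A e : R) : 0 < A -> 0 < e ->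
  exists u1, 0 <= u1 < A /\ forall u, u1 < u < A -> Rabs (abel g A u - abel_full g A) < e.
Proof.
  intros HA He.
  assert (C : continuity_pt (RInt (fun th => g (A * sin th)) 0) (PI / 2))
    by (eapply continuity_pt_of_is_derive, is_derive_theta_integral).
  destruct (C e He) as [d [Hd H]]. simpl in H. unfold Rdist in H.
  pose proof PI_RGT_0 as HPI.
  set (d' := Rmin d (PI / 2)).
  assert (Hd' : 0 < d' <= PI / 2 /\ d' <= d).
  { unfold d'. split; [split; [apply Rmin_glb_lt; lra | apply Rmin_r] | apply Rmin_l]. }
  assert (Hs : 0 <= sin (PI / 2 - d')) by (apply sin_ge_0; lra).
  assert (Hs1 : sin (PI / 2 - d') < 1).
  { rewrite <- sin_PI2. apply sin_increasing_1; lra. }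
  exists (A * sin (PI / 2 - d')). split; [nra|]. intros u Hu.
  assert (HuA : u = A * (u / A)) by (field; lra).
  assert (Hx : -1 < u / A < 1) by (split; nra).
  pose proof (asin_bound_lt _ Hx) as Hb. pose proof (sin_asin (u / A) ltac:(lra)) as Es.
  set (th := asin (u / A)) in *. rewrite <- Es in HuA.
  assert (Hth : PI / 2 - d' < th).
  { apply Rnot_le_lt. intros Hn.
    assert (sin th <= sin (PI / 2 - d')) by (apply sin_incr_1; lra). nra. }
  rewrite HuA, abel_sin by auto.
  apply H. split; [split; [exact I | lra]|]. apply Rabs_def1; lra.
Qed.

Lemma differentiable_pt_lim_abel (A u : R) : Rabs u < A ->
  differentiable_pt_lim (abel g) A u (abel_dA g A u) (g u / sqrt (A ^ 2 - u ^ 2)).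
Proof.
  intros H. apply filterdiff_differentiable_pt_lim.
  apply (is_derive_filterdiff (abel g) A u (abel_dA g) (g u / sqrt (A ^ 2 - u ^ 2))).
  - apply (locally_2d_locally (fun x y => is_derive (fun z => abel g z y) x (abel_dA g x y))).
    assert (Hd : 0 < (A - Rabs u) / 2) by lra.
    exists (mkposreal _ Hd). intros A' u' H1 H2. simpl in H1, H2.
    apply is_derive_abel_A; auto. apply Rabs_def2 in H1. pose proof (Rabs_triang (u' - u) u).
    replace (u' - u + u) with u' in H0 by ring. lra.
  - now apply is_derive_abel_u.
  - apply continuity_2d_pt_filterlim. now apply continuity_2d_pt_abel_dA.
Qed.

(** The cut is at an angle [th n] independent of [A]. Expressed in [v], the truncated integral is
    [abel g A (A * sin (th n))], which is C^1 in [A] for merely continuous [g]. The tail runs over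
    an angular interval of length [1 / (n + 1)], on which [g (A * sin t)] is Lipschitz in [A], and
    this is the error bound [C1_of_lipschitz_approx] asks for. *)
Lemma abel_full_C1 : locally_lipschitz_on_pos g ->
  exists dV, forall A, 0 < A -> is_derive (abel_full g) A (dV A) /\ continuity_pt dV A.
Proof.
  intros Hlip. pose proof PI_RGT_0 as HPI. pose proof PI2_1 as HPI2.
  set (th := fun n : nat => PI / 2 - / (INR n + 1)).
  assert (Hth : forall n, - (PI / 2) < th n < PI / 2).
  { intros n. unfold th. pose proof (pos_INR n).
    assert (0 < / (INR n + 1)) by (apply Rinv_0_lt_compat; lra).
    assert (/ (INR n + 1) <= 1) by (rewrite <- Rinv_1; apply Rinv_le_contravar; lra). lra. }
  assert (Hgap : forall n A, 0 < A -> Rabs (A * sin (th n)) < A).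
  { intros n A HA. assert (0 < cos (th n)) by (apply cos_gt_0; apply Hth).
    assert (sin (th n) ^ 2 + cos (th n) ^ 2 = 1) by (rewrite <- !Rsqr_pow2; apply sin2_cos2).
    assert (-1 < sin (th n) < 1) by nra. apply Rabs_def1; nra. }
  apply (C1_of_lipschitz_approx (abel_full g) (fun n A => abel g A (A * sin (th n)))
    (fun n A => abel_dA g A (A * sin (th n)) * 1 +
       g (A * sin (th n)) / sqrt (A ^ 2 - (A * sin (th n)) ^ 2) * sin (th n))).
  - intros n A HA. specialize (Hgap n A HA). split.
    + apply is_derive_Reals.
      apply (derivable_pt_lim_comp_2d (abel g) (fun A => A) (fun A => A * sin (th n))).
      * now apply differentiable_pt_lim_abel.
      * apply derivable_pt_lim_id.
      * apply is_derive_Reals. auto_derive; auto; ring.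
    + apply (continuity_2d_pt_slice1 (fun A (_ : R) => abel_dA g A (A * sin (th n)) * 1 +
        g (A * sin (th n)) / sqrt (A ^ 2 - (A * sin (th n)) ^ 2) * sin (th n)) A 0).
      pose proof (sqrt_gap_pos _ _ Hgap). unfold Rdiv. cont2; [| |lra].
      * apply (continuity_2d_pt_comp2 (abel_dA g) (fun A _ => A) (fun A _ => A * sin (th n))); cont2.
        now apply continuity_2d_pt_abel_dA.
      * apply (continuity_1d_2d_pt_comp g (fun A _ => A * sin (th n))); cont2. apply g_cont.
  - intros A HA. destruct (Hlip A HA) as (r & M & Hr & HM & Hg).
    (* If [1 - sin t < r / (2 A)] and [|x - A| < r / 2], then [x * sin t] is within [r] of [A], each
       of the two deviations costing at most [r / 2]. Thus the whole tail stays where [g] is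
       Lipschitz. *)
    assert (He : 0 < r / 2 / A) by (repeat apply Rdiv_lt_0_compat; lra).
    destruct (continuity_sin (PI / 2) (r / 2 / A) He) as [eta [Heta Hsin]].
    simpl in Hsin. unfold Rdist in Hsin. rewrite sin_PI2 in Hsin.
    destruct (div_succ_small 1 eta) as [N HN]; [lra|lra|].
    exists (Rmin (r / 2) A), M, N.
    split; [apply Rmin_glb_lt; lra|]. split; [exact HM|].
    assert (Hball : forall y, Rabs (y - A) < Rmin (r / 2) A -> Rabs (y - A) < r / 2 /\ 0 < y).
    { intros y Hy. pose proof (Rmin_l (r / 2) A). pose proof (Rmin_r (r / 2) A).
      split; [lra|]. apply Rabs_def2 in Hy. lra. }
    split; [intros y Hy; now apply Hball|].
    intros n y z Hn Hy Hz. apply Hball in Hy, Hz. destruct Hy as [Hy Hy0], Hz as [Hz Hz0].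
    assert (Ex : forall x t s, ex_RInt (fun th => g (x * sin th)) t s).
    { intros x t s. apply ex_RInt_of_continuity. intros q _. now apply continuity_pt_theta. }
    assert (Tail : forall x, 0 < x -> abel_full g x - abel g x (x * sin (th n)) =
      RInt (fun th => g (x * sin th)) (th n) (PI / 2)).
    { intros x Hx. rewrite abel_sin by auto. unfold abel_full.
      rewrite <- (RInt_Chasles_R _ 0 (th n) (PI / 2)) by apply Ex. ring. }
    rewrite !Tail by auto. rewrite <- RInt_minus_R by apply Ex.
    assert (Ew : PI / 2 - th n = / (INR n + 1)) by (unfold th; ring).
    assert (Hw : 0 < / (INR n + 1)) by (apply Rinv_0_lt_compat; pose proof (pos_INR n); lra).
    replace (M / (INR n + 1) * Rabs (y - z)) with (M * Rabs (y - z) * Rabs (PI / 2 - th n)).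
    2:{ rewrite Ew, (Rabs_right (/ _)) by lra. unfold Rdiv. ring. }
    apply abs_RInt_le.
    + intros t _. apply (continuity_pt_minus (fun th => g (y * sin th)) (fun th => g (z * sin th)));
        now apply continuity_pt_theta.
    + intros t Ht. rewrite Rmin_left, Rmax_right in Ht by (specialize (Hth n); lra).
      specialize (HN n Hn). replace (1 / (INR n + 1)) with (/ (INR n + 1)) in HN by (unfold Rdiv; ring).
      assert (St : 1 - r / 2 / A < sin t <= 1).
      { split; [|apply SIN_bound]. destruct (Req_dec t (PI / 2)) as [->|Hne].
        - rewrite sin_PI2. lra.
        - assert (Q : Rabs (sin t - 1) < r / 2 / A).
          { apply Hsin. split; [split; [exact I|auto]|]. apply Rabs_def1; lra. }
          apply Rabs_def2 in Q. lra. }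
      assert (S0 : Rabs (sin t) <= 1) by (apply Rabs_le, SIN_bound).
      assert (Near : forall x, Rabs (x - A) < r / 2 -> Rabs (x * sin t - A) < r).
      { intros x Hx. replace (x * sin t - A) with ((x - A) * sin t - A * (1 - sin t)) by ring.
        eapply Rle_lt_trans; [apply Rabs_triang|]. rewrite Rabs_Ropp, !Rabs_mult.
        rewrite (Rabs_right A), (Rabs_right (1 - sin t)) by lra.
        assert (A * (1 - sin t) < r / 2).
        { replace (r / 2) with (A * (r / 2 / A)) by (field; lra).
          apply Rmult_lt_compat_l; lra. }
        pose proof (Rabs_pos (x - A)). nra. }
      eapply Rle_trans; [apply Hg; now apply Near|].
      replace (y * sin t - z * sin t) with ((y - z) * sin t) by ring.
      rewrite Rabs_mult. pose proof (Rabs_pos (y - z)).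
      apply Rmult_le_compat_l; [lra|]. nra.
Qed.

End EndpointValue.

Lemma abel_Rabs (A u : R) : 0 <= u < A -> abel Rabs A u = A - sqrt (A ^ 2 - u ^ 2).
Proof.
  intros Hu. unfold abel. apply (is_RInt_unique (V := R_CompleteNormedModule)).
  replace (A - sqrt (A ^ 2 - u ^ 2))
    with (minus (- sqrt (A ^ 2 - u ^ 2)) (- sqrt (A ^ 2 - 0 ^ 2))).
  2:{ replace (A ^ 2 - 0 ^ 2) with (A ^ 2) by ring. rewrite sqrt_pow2 by lra.
      unfold minus, plus, opp; simpl. ring. }
  apply (is_RInt_derive (V := R_CompleteNormedModule) (fun v => - sqrt (A ^ 2 - v ^ 2))).
  - intros v Hv. rewrite Rmin_left, Rmax_right in Hv by lra.
    assert (Hg : Rabs v < A) by (rewrite Rabs_right; lra).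
    pose proof (sqrt_gap_pos A v Hg). pose proof (sq_lt_of_abs A v Hg).
    rewrite Rabs_right by lra.
    auto_derive; replace (A * (A * 1) + - (v * (v * 1))) with (A ^ 2 - v ^ 2) by ring;
      [auto | field; lra].
  - intros v Hv. rewrite Rmin_left, Rmax_right in Hv by lra. apply continuity_pt_filterlim.
    apply (continuity_2d_pt_slice2 (fun A v => Rabs v / sqrt (A ^ 2 - v ^ 2))).
    apply continuity_2d_pt_kernel; [apply Rcontinuity_abs|]. rewrite Rabs_right; lra.
Qed.

(** * Monotonicity and range of the incomplete integral *)

Section Monotone.
Variable p : R -> R.
Hypothesis p_cont : forall u, continuity_pt p u.
Hypothesis p_pos : forall u, u <> 0 -> 0 < p u.

(** The integrand may vanish at [0], so the mean value theorem is strict only on intervals without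
    [0] in their interior; an interval across [0] is cut there. *)
Lemma abel_lt (A u1 u2 : R) : - A < u1 -> u1 < u2 -> u2 < A -> abel p A u1 < abel p A u2.
Proof.
  assert (Side : forall u1 u2, - A < u1 -> u1 < u2 -> u2 < A -> (0 <= u1 \/ u2 <= 0) ->
    abel p A u1 < abel p A u2).
  { clear u1 u2. intros u1 u2 H1 H2 H3 Hs.
    destruct (MVT_cor2 (abel p A) (fun u => p u / sqrt (A ^ 2 - u ^ 2)) u1 u2 H2) as [c [E Hc]].
    - intros c Hc. apply is_derive_Reals, is_derive_abel_u; auto. apply Rabs_def1; lra.
    - assert (0 < p c) by (apply p_pos; lra).
      assert (0 < sqrt (A ^ 2 - c ^ 2)) by (apply sqrt_gap_pos, Rabs_def1; lra).
      assert (0 < p c / sqrt (A ^ 2 - c ^ 2)) by now apply Rdiv_lt_0_compat. nra. }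
  intros H1 H2 H3. destruct (Rle_dec 0 u1); [apply Side; auto|].
  destruct (Rle_dec u2 0); [apply Side; auto|].
  apply Rlt_trans with (abel p A 0); apply Side; lra.
Qed.

(** Source of the existence of [t0]: as [abel p A] is odd and approaches [abel_full p A], the
    intermediate value theorem applies between [- u2] and [u2] for [u2] close to [A]. *)
Lemma abel_surj (A y : R) : (forall u, p (- u) = p u) -> 0 < A -> Rabs y < abel_full p A ->
  exists u, Rabs u < A /\ abel p A u = y.
Proof.
  intros Hev HA Hy. apply Rabs_def2 in Hy.
  set (N := (abel_full p A - Rabs y)).
  assert (HN : 0 < N) by (unfold N; assert (Rabs y < abel_full p A) by (apply Rabs_def1; lra); lra).
  destruct (abel_near_full p p_cont A N HA HN) as [u1 [Hu1 Hn]].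
  set (u2 := (u1 + A) / 2). specialize (Hn u2 ltac:(unfold u2; lra)).
  assert (H2 : 0 < u2 < A) by (unfold u2; lra).
  apply Rabs_def2 in Hn.
  assert (Hup : Rabs y < abel p A u2) by (unfold N in Hn; lra).
  assert (Hlo : abel p A (- u2) = - abel p A u2) by (apply abel_opp; auto; apply Rabs_def1; lra).
  destruct (IVT_interv (fun u => abel p A u - y) (- u2) u2) as [u [Hu E]].
  - intros u Hu. apply continuity_pt_minus; [|apply continuity_pt_const; intros ? ?; reflexivity].
    eapply continuity_pt_of_is_derive, is_derive_abel_u; auto. apply Rabs_def1; lra.
  - lra.
  - rewrite Hlo. pose proof (Rle_abs (- y)). rewrite Rabs_Ropp in H. lra.
  - pose proof (Rle_abs y). lra.
  - exists u. split; [apply Rabs_def1; lra | lra].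
Qed.

End Monotone.

(** * The metric coefficient in the chart (tau, u) *)

(* [Psi (a tau) u = (a tau)^2 (1 - adot f) / adot]. The last term, an odd extension of
   [abel_full w A * (A - c)], encodes the reflection rule defining [f] for negative [t0]. *)
Definition Psi (p w : R -> R) (A u : R) : R :=
  A * abel_full w A + u * p u - sqrt (A ^ 2 - u ^ 2) * abel w A u - abel_full w A * abel Rabs A u.
Definition PsiA (w dVw : R -> R) (A u : R) : R :=
  abel_full w A + A * dVw A
  - (A / sqrt (A ^ 2 - u ^ 2) * abel w A u + sqrt (A ^ 2 - u ^ 2) * abel_dA w A u)
  - (dVw A * abel Rabs A u + abel_full w A * abel_dA Rabs A u).
(** What is left of the [u]-derivative of [Psi] once [p u / sqrt (A^2 - u^2)] is factored out. Here
    [l] is the expansion rate as a function of [u], so that [|u| = p u * l u] contains the factor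
    [p u]. *)
Definition slope (w l : R -> R) (A u : R) : R :=
  sqrt (A ^ 2 - u ^ 2) + l u * (abel w A (Rabs u) - abel_full w A).

Section Chart.
Variables p w l dVp dVw : R -> R.
Hypothesis p_cont : forall u, continuity_pt p u.
Hypothesis w_cont : forall u, continuity_pt w u.
Hypothesis l_cont : forall u, continuity_pt l u.
Hypothesis p_even : forall u, p (- u) = p u.
Hypothesis w_even : forall u, w (- u) = w u.
Hypothesis p_0 : p 0 = 0.
Hypothesis p_pos : forall u, u <> 0 -> 0 < p u.
Hypothesis p_l : forall u, p u * l u = Rabs u.
Hypothesis p_deriv : forall u, is_derive (fun u => u * p u) u (p u + w u).
Hypothesis Vp_C1 : forall A, 0 < A -> is_derive (abel_full p) A (dVp A) /\ continuity_pt dVp A.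
Hypothesis Vw_C1 : forall A, 0 < A -> is_derive (abel_full w) A (dVw A) /\ continuity_pt dVw A.

Lemma Psi_opp (A u : R) : Rabs u < A -> Psi p w A (- u) = 2 * A * abel_full w A - Psi p w A u.
Proof.
  intros H. unfold Psi. rewrite !abel_opp, p_even; auto using Rcontinuity_abs, Rabs_Ropp.
  replace ((- u) ^ 2) with (u ^ 2) by ring. ring.
Qed.

Lemma is_derive_gap_u (A u : R) : Rabs u < A ->
  is_derive (fun u => sqrt (A ^ 2 - u ^ 2)) u (- u / sqrt (A ^ 2 - u ^ 2)).
Proof.
  intros H. pose proof (sqrt_gap_pos A u H). pose proof (sq_lt_of_abs A u H).
  auto_derive; replace (A * (A * 1) + - (u * (u * 1))) with (A ^ 2 - u ^ 2) by ring;
    [auto | field; lra].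
Qed.

Lemma is_derive_gap_A (A u : R) : Rabs u < A ->
  is_derive (fun A => sqrt (A ^ 2 - u ^ 2)) A (A / sqrt (A ^ 2 - u ^ 2)).
Proof.
  intros H. pose proof (sqrt_gap_pos A u H). pose proof (sq_lt_of_abs A u H).
  auto_derive; replace (A * (A * 1) + - (u * (u * 1))) with (A ^ 2 - u ^ 2) by ring;
    [auto | field; lra].
Qed.

(** The [w u] from differentiating [u * p u] cancels the one from differentiating [abel w]. All
    other terms are [p u] or multiples of [|u|], hence multiples of [p u] by [p_l]. *)
Lemma is_derive_Psi_u (A u : R) : Rabs u < A ->
  is_derive (Psi p w A) u (slope w l A u * (p u / sqrt (A ^ 2 - u ^ 2))).
Proof.
  intros H. pose proof (sqrt_gap_pos A u H) as Hc.
  set (c := sqrt (A ^ 2 - u ^ 2)) in *.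
  (* Since [w] is even, [abel w A] is odd in [u], and the product with [u] depends on [|u|] only. *)
  assert (E : u * abel w A u = Rabs u * abel w A (Rabs u)).
  { unfold Rabs at 1 2. destruct (Rcase_abs u); [|reflexivity].
    rewrite abel_opp; auto. ring. }
  replace (slope w l A u * (p u / c)) with
    (minus (minus (plus 0 (p u + w u))
       (plus (mult (- u / c) (abel w A u)) (mult c (w u / c))))
     (abel_full w A * (Rabs u / c))).
  2:{ unfold slope. fold c.
      change (0 + (p u + w u) + - (- u / c * abel w A u + c * (w u / c)) + - (abel_full w A * (Rabs u / c))
        = (c + l u * (abel w A (Rabs u) - abel_full w A)) * (p u / c)).
      apply eq_sym, Rminus_diag_uniq.
      transitivity (((p u * l u - Rabs u) * (abel w A (Rabs u) - abel_full w A)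
        - (u * abel w A u - Rabs u * abel w A (Rabs u))) / c); [field; lra|].
      rewrite p_l, E. field. lra. }
  apply (is_derive_minus (V := R_NormedModule)
    (fun u => A * abel_full w A + u * p u - sqrt (A ^ 2 - u ^ 2) * abel w A u) (fun u => abel_full w A * abel Rabs A u)).
  - apply (is_derive_minus (V := R_NormedModule) (fun u => A * abel_full w A + u * p u)
      (fun u => sqrt (A ^ 2 - u ^ 2) * abel w A u)).
    + apply (is_derive_plus (V := R_NormedModule) (fun u => A * abel_full w A) (fun u => u * p u)).
      * apply (is_derive_const (A * abel_full w A)).
      * apply p_deriv.
    + apply (is_derive_mult (fun u => sqrt (A ^ 2 - u ^ 2)) (abel w A)).
      * now apply is_derive_gap_u.
      * now apply is_derive_abel_u.
      * intros; apply Rmult_comm.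
  - apply is_derive_scal. apply is_derive_abel_u; auto using Rcontinuity_abs.
Qed.

Lemma is_derive_Psi_A (A u : R) : Rabs u < A ->
  is_derive (fun A => Psi p w A u) A (PsiA w dVw A u).
Proof.
  intros H. assert (HA : 0 < A) by (pose proof (Rabs_pos u); lra).
  unfold PsiA.
  replace (abel_full w A + A * dVw A) with (plus (plus (mult 1 (abel_full w A)) (mult A (dVw A))) 0)
    by (unfold plus, mult; simpl; unfold mult; simpl; ring).
  apply (is_derive_minus (V := R_NormedModule)
    (fun A => A * abel_full w A + u * p u - sqrt (A ^ 2 - u ^ 2) * abel w A u) (fun A => abel_full w A * abel Rabs A u)).
  - apply (is_derive_minus (V := R_NormedModule) (fun A => A * abel_full w A + u * p u)
      (fun A => sqrt (A ^ 2 - u ^ 2) * abel w A u)).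
    + apply (is_derive_plus (V := R_NormedModule) (fun A => A * abel_full w A) (fun A => u * p u)).
      * apply (is_derive_mult (fun A => A) (abel_full w)); [apply (is_derive_id A) | now apply Vw_C1 |].
        intros; apply Rmult_comm.
      * apply (is_derive_const (u * p u)).
    + apply (is_derive_mult (fun A => sqrt (A ^ 2 - u ^ 2)) (fun A => abel w A u)).
      * now apply is_derive_gap_A.
      * now apply is_derive_abel_A.
      * intros; apply Rmult_comm.
  - apply (is_derive_mult (abel_full w) (fun A => abel Rabs A u)).
    * now apply Vw_C1.
    * apply is_derive_abel_A; auto using Rcontinuity_abs.
    * intros; apply Rmult_comm.
Qed.

Lemma continuity_2d_pt_abel_full_fst (g dV : R -> R) (A u : R) :
  (forall A, 0 < A -> is_derive (abel_full g) A (dV A) /\ continuity_pt dV A) -> 0 < A ->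
  continuity_2d_pt (fun A _ => abel_full g A) A u.
Proof.
  intros HV HA. apply (continuity_1d_2d_pt_comp (abel_full g) (fun A _ => A)); cont2.
  eapply continuity_pt_of_is_derive. now apply HV.
Qed.

Lemma continuity_2d_pt_fst (g : R -> R) (A u : R) :
  continuity_pt g A -> continuity_2d_pt (fun A _ => g A) A u.
Proof. intros H. apply (continuity_1d_2d_pt_comp g (fun A _ => A)); cont2. Qed.

Lemma continuity_2d_pt_snd (g : R -> R) (A u : R) :
  continuity_pt g u -> continuity_2d_pt (fun _ u => g u) A u.
Proof. intros H. apply (continuity_1d_2d_pt_comp g (fun _ u => u)); cont2. Qed.

Lemma continuity_2d_pt_Psi (A u : R) : Rabs u < A -> continuity_2d_pt (Psi p w) A u.
Proof.
  intros H. assert (HA : 0 < A) by (pose proof (Rabs_pos u); lra).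
  pose proof (continuity_2d_pt_abel_full_fst w dVw A u Vw_C1 HA).
  pose proof (continuity_2d_pt_abel w w_cont A u H).
  pose proof (continuity_2d_pt_abel Rabs Rcontinuity_abs A u H).
  pose proof (continuity_2d_pt_snd p A u (p_cont u)).
  unfold Psi. cont2.
Qed.

Lemma continuity_2d_pt_PsiA (A u : R) : Rabs u < A -> continuity_2d_pt (PsiA w dVw) A u.
Proof.
  intros H. assert (HA : 0 < A) by (pose proof (Rabs_pos u); lra).
  pose proof (sqrt_gap_pos A u H).
  pose proof (continuity_2d_pt_abel_full_fst w dVw A u Vw_C1 HA).
  pose proof (continuity_2d_pt_fst dVw A u (proj2 (Vw_C1 A HA))).
  pose proof (continuity_2d_pt_abel w w_cont A u H).
  pose proof (continuity_2d_pt_abel Rabs Rcontinuity_abs A u H).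
  pose proof (continuity_2d_pt_abel_dA w w_cont A u H).
  pose proof (continuity_2d_pt_abel_dA Rabs Rcontinuity_abs A u H).
  unfold PsiA, Rdiv. cont2. lra.
Qed.

Lemma continuity_2d_pt_slope (A u : R) : Rabs u < A -> continuity_2d_pt (slope w l) A u.
Proof.
  intros H. assert (HA : 0 < A) by (pose proof (Rabs_pos u); lra).
  pose proof (continuity_2d_pt_abel_full_fst w dVw A u Vw_C1 HA).
  pose proof (continuity_2d_pt_snd l A u (l_cont u)).
  unfold slope. cont2.
  apply (continuity_2d_pt_comp2 (abel w) (fun A _ => A) (fun _ u => Rabs u)); cont2.
  apply continuity_2d_pt_abel; auto. now rewrite Rabs_Rabsolu.
Qed.

Variables a ad ad2 : R -> R.
Hypothesis a_pos : forall t, 0 < t -> 0 < a t.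
Hypothesis a_deriv : forall t, 0 < t -> is_derive a t (ad t).
Hypothesis ad_deriv : forall t, 0 < t -> is_derive ad t (ad2 t).
Hypothesis ad2_cont : forall t, 0 < t -> continuity_pt ad2 t.

Definition gtt_chart (t u : R) : R := - (ad t * Psi p w (a t) u / a t ^ 2) ^ 2.
Definition rho_chart (t u : R) : R := abel_full p (a t) - abel p (a t) u.
(** The quotient of the [u]-derivatives of [gtt_chart] and [rho_chart] after cancelling their common
    factor, hence meaningful at [u = 0] too. It turns out to be the partial derivative of the metric
    coefficient in [rho]. *)
Definition gtt_rho (t u : R) : R :=
  2 * (ad t / a t ^ 2) ^ 2 * Psi p w (a t) u * slope w l (a t) u.
Definition gtt_t (t u : R) : R :=
  - 2 * (ad t * Psi p w (a t) u / a t ^ 2) *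
  ((ad2 t * Psi p w (a t) u + ad t * (ad t * PsiA w dVw (a t) u)) / a t ^ 2
   - 2 * ad t * (ad t * Psi p w (a t) u) / a t ^ 3).
Definition rho_t (t u : R) : R := ad t * (dVp (a t) - abel_dA p (a t) u).

Lemma continuity_2d_pt_at_a (f : R -> R -> R) (t u : R) : 0 < t ->
  continuity_2d_pt f (a t) u -> continuity_2d_pt (fun t u => f (a t) u) t u.
Proof.
  intros Ht H. apply (continuity_2d_pt_comp2 f (fun t _ => a t) (fun _ u => u)); cont2.
  apply continuity_2d_pt_fst. eapply continuity_pt_of_is_derive. now apply a_deriv.
Qed.

Lemma is_derive_at_a (f : R -> R) (t l' : R) : 0 < t -> is_derive f (a t) l' ->
  is_derive (fun t => f (a t)) t (ad t * l').
Proof. intros Ht H. apply (is_derive_comp f a); auto. Qed.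

Lemma is_derive_gtt_u (t u : R) : 0 < t -> Rabs u < a t ->
  is_derive (gtt_chart t) u (gtt_rho t u * - (p u / sqrt (a t ^ 2 - u ^ 2))).
Proof.
  intros Ht H. pose proof (is_derive_Psi_u (a t) u H) as HP. pose proof (a_pos t Ht).
  pose proof (sqrt_gap_pos _ _ H).
  unfold gtt_chart. auto_derive; [eexists; exact HP|].
  replace (Derive _ u) with (slope w l (a t) u * (p u / sqrt (a t ^ 2 - u ^ 2)))
    by (symmetry; now apply is_derive_unique).
  unfold gtt_rho. field. lra.
Qed.

Lemma is_derive_rho_u (t u : R) : 0 < t -> Rabs u < a t ->
  is_derive (rho_chart t) u (- (p u / sqrt (a t ^ 2 - u ^ 2))).
Proof.
  intros Ht H. pose proof (is_derive_abel_u p p_cont (a t) u H) as HP.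
  unfold rho_chart. auto_derive; [eexists; exact HP|].
  replace (Derive _ u) with (p u / sqrt (a t ^ 2 - u ^ 2))
    by (symmetry; now apply is_derive_unique).
  ring.
Qed.

Lemma is_derive_gtt_t (t u : R) : 0 < t -> Rabs u < a t ->
  is_derive (fun t => gtt_chart t u) t (gtt_t t u).
Proof.
  intros Ht H. pose proof (is_derive_at_a _ t _ Ht (is_derive_Psi_A (a t) u H)) as HP.
  pose proof (a_pos t Ht) as Ha. pose proof (a_deriv t Ht) as Da. pose proof (ad_deriv t Ht) as Dad.
  set (Q := fun t => Psi p w (a t) u) in *.
  change (is_derive (fun t => - (ad t * Q t / a t ^ 2) ^ 2) t (gtt_t t u)).
  auto_derive.
  - repeat split; try (eexists; eassumption). rewrite Rmult_1_r. nra.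
  - replace (Derive (fun x => Q x) t) with (ad t * PsiA w dVw (a t) u)
      by (symmetry; now apply is_derive_unique).
    replace (Derive (fun x => a x) t) with (ad t) by (symmetry; now apply is_derive_unique).
    replace (Derive (fun x => ad x) t) with (ad2 t) by (symmetry; now apply is_derive_unique).
    unfold gtt_t. fold (Q t). field. lra.
Qed.

Lemma is_derive_rho_t (t u : R) : 0 < t -> Rabs u < a t ->
  is_derive (fun t => rho_chart t u) t (rho_t t u).
Proof.
  intros Ht H. unfold rho_chart, rho_t.
  replace (ad t * (dVp (a t) - abel_dA p (a t) u)) with (ad t * dVp (a t) - ad t * abel_dA p (a t) u) by ring.
  apply (is_derive_minus (V := R_NormedModule) (fun t => abel_full p (a t)) (fun t => abel p (a t) u)).
  - apply is_derive_at_a; auto. apply Vp_C1; auto.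
  - apply (is_derive_at_a (fun A => abel p A u)); auto. now apply is_derive_abel_A.
Qed.

Lemma continuity_2d_pt_gtt_rho (t u : R) : 0 < t -> Rabs u < a t ->
  continuity_2d_pt gtt_rho t u.
Proof.
  intros Ht H. pose proof (a_pos t Ht).
  assert (Ca : continuity_2d_pt (fun t _ => a t) t u)
    by (apply continuity_2d_pt_fst; eapply continuity_pt_of_is_derive; now apply a_deriv).
  assert (Cad : continuity_2d_pt (fun t _ => ad t) t u)
    by (apply continuity_2d_pt_fst; eapply continuity_pt_of_is_derive; now apply ad_deriv).
  pose proof (continuity_2d_pt_at_a _ t u Ht (continuity_2d_pt_Psi _ u H)).
  pose proof (continuity_2d_pt_at_a _ t u Ht (continuity_2d_pt_slope _ u H)).
  unfold gtt_rho, Rdiv. cont2. all: apply pow_nonzero; lra.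
Qed.

Lemma continuity_2d_pt_gtt_t (t u : R) : 0 < t -> Rabs u < a t ->
  continuity_2d_pt gtt_t t u.
Proof.
  intros Ht H. pose proof (a_pos t Ht).
  assert (Ca : continuity_2d_pt (fun t _ => a t) t u)
    by (apply continuity_2d_pt_fst; eapply continuity_pt_of_is_derive; now apply a_deriv).
  assert (Cad : continuity_2d_pt (fun t _ => ad t) t u)
    by (apply continuity_2d_pt_fst; eapply continuity_pt_of_is_derive; now apply ad_deriv).
  pose proof (continuity_2d_pt_fst ad2 t u (ad2_cont t Ht)).
  pose proof (continuity_2d_pt_at_a _ t u Ht (continuity_2d_pt_Psi _ u H)).
  pose proof (continuity_2d_pt_at_a _ t u Ht (continuity_2d_pt_PsiA _ u H)).
  unfold gtt_t, Rdiv. cont2; apply pow_nonzero; lra.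
Qed.

Lemma continuity_2d_pt_rho_t (t u : R) : 0 < t -> Rabs u < a t ->
  continuity_2d_pt rho_t t u.
Proof.
  intros Ht H. pose proof (a_pos t Ht) as Ha.
  assert (Cad : continuity_2d_pt (fun t _ => ad t) t u)
    by (apply continuity_2d_pt_fst; eapply continuity_pt_of_is_derive; now apply ad_deriv).
  pose proof (continuity_2d_pt_at_a (fun A _ => dVp A) t u Ht
    (continuity_2d_pt_fst dVp (a t) u (proj2 (Vp_C1 _ Ha)))).
  pose proof (continuity_2d_pt_at_a _ t u Ht (continuity_2d_pt_abel_dA p p_cont _ u H)).
  unfold rho_t. cont2.
Qed.

Variable U : R -> R -> R.
Definition chart_range (t r : R) : Prop := 0 < t /\ 0 < r < 2 * abel_full p (a t).
Hypothesis U_spec : forall t r, chart_range t r -> Rabs (U t r) < a t /\ rho_chart t (U t r) = r.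

Lemma chart_range_open (t r : R) : chart_range t r -> locally_2d chart_range t r.
Proof.
  intros [Ht Hr].
  assert (C : continuity_pt (fun t => abel_full p (a t)) t).
  { eapply continuity_pt_of_is_derive, is_derive_at_a; auto. apply Vp_C1; auto. }
  assert (He : 0 < (2 * abel_full p (a t) - r) / 3) by lra.
  destruct (C _ He) as [d [Hd H]]. simpl in H. unfold Rdist in H.
  set (d' := Rmin (Rmin d t) (Rmin r ((2 * abel_full p (a t) - r) / 3))).
  assert (Hd' : 0 < d') by (repeat apply Rmin_glb_lt; lra).
  assert (Hb : d' <= d /\ d' <= t /\ d' <= r /\ d' <= (2 * abel_full p (a t) - r) / 3)
    by (unfold d', Rmin; repeat destruct Rle_dec; lra).
  exists (mkposreal d' Hd'). simpl. intros t' r' H1 H2.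
  assert (Hv : Rabs (abel_full p (a t') - abel_full p (a t)) < (2 * abel_full p (a t) - r) / 3).
  { destruct (Req_dec t' t) as [->|Hn]; [rewrite Rminus_diag, Rabs_R0; lra|].
    apply H. split; [split; [exact I | auto]|]. lra. }
  apply Rabs_def2 in H1, H2, Hv. split; lra.
Qed.

(** The inverse is trapped by monotonicity: [rho_chart] lies strictly above [r] at [u - e] and
    strictly below it at [u + e], both persist for nearby [(t', r')], and so [U t' r'] lies between.
    This works at [u = 0], where the derivative of [rho_chart] vanishes. *)
Lemma continuity_2d_pt_U (t r : R) : chart_range t r -> continuity_2d_pt U t r.
Proof.
  intros Htr eps. destruct (U_spec t r Htr) as [Hu Eu]. destruct Htr as [Ht Hr] eqn:E. clear E.
  set (u := U t r) in *. assert (Hu' := Rabs_def2 _ _ Hu).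
  (* Besides [e < eps], this leaves a margin [e] between [u - e], [u + e] and the ends [- a t],
     [a t], so both points stay admissible when [a t'] differs from [a t] by less than [e / 2]. *)
  set (e := Rmin (eps / 2) (Rmin ((a t - u) / 2) ((u + a t) / 2))).
  assert (He : 0 < e).
  { repeat apply Rmin_glb_lt; try lra. apply is_pos_div_2. }
  assert (Hb : e <= eps / 2 /\ e <= (a t - u) / 2 /\ e <= (u + a t) / 2)
    by (unfold e, Rmin; repeat destruct Rle_dec; lra).
  pose proof (cond_pos eps) as Heps.
  assert (Lo : rho_chart t (u - e) > r).
  { rewrite <- Eu. unfold rho_chart. pose proof (abel_lt p p_cont p_pos (a t) (u - e) u). lra. }
  assert (Hi : rho_chart t (u + e) < r).
  { rewrite <- Eu. unfold rho_chart. pose proof (abel_lt p p_cont p_pos (a t) u (u + e)). lra. }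
  assert (C : forall v, Rabs v < a t -> continuity_pt (fun t => rho_chart t v) t).
  { intros v Hv. eapply continuity_pt_of_is_derive. now apply is_derive_rho_t. }
  assert (H1 : 0 < (rho_chart t (u - e) - r) / 2) by lra.
  assert (H2 : 0 < (r - rho_chart t (u + e)) / 2) by lra.
  destruct (C (u - e) ltac:(apply Rabs_def1; lra) _ H1) as [d1 [Hd1 C1]].
  destruct (C (u + e) ltac:(apply Rabs_def1; lra) _ H2) as [d2 [Hd2 C2]].
  assert (Ca : continuity_pt a t) by (eapply continuity_pt_of_is_derive; now apply a_deriv).
  assert (H3 : 0 < e / 2) by lra.
  destruct (Ca _ H3) as [d3 [Hd3 C3]].
  destruct (chart_range_open t r Htr) as [d4 H4].
  simpl in C1, C2, C3. unfold Rdist in C1, C2, C3.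
  set (d := Rmin (Rmin (Rmin d1 d2) (Rmin d3 d4))
    (Rmin ((rho_chart t (u - e) - r) / 2) ((r - rho_chart t (u + e)) / 2))).
  assert (Hd : 0 < d) by (repeat apply Rmin_glb_lt; auto; apply cond_pos).
  assert (Hbd : d <= d1 /\ d <= d2 /\ d <= d3 /\ d <= d4 /\
    d <= (rho_chart t (u - e) - r) / 2 /\ d <= (r - rho_chart t (u + e)) / 2).
  { unfold d, Rmin. repeat destruct Rle_dec; lra. }
  exists (mkposreal d Hd). simpl. intros t' r' Ht' Hr'.
  destruct (U_spec t' r' (H4 t' r' ltac:(lra) ltac:(lra))) as [Hv Ev].
  set (v := U t' r') in *. assert (Hv' := Rabs_def2 _ _ Hv).
  assert (Q : Rabs (rho_chart t' (u - e) - rho_chart t (u - e)) < (rho_chart t (u - e) - r) / 2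
    /\ Rabs (rho_chart t' (u + e) - rho_chart t (u + e)) < (r - rho_chart t (u + e)) / 2
    /\ Rabs (a t' - a t) < e / 2).
  { destruct (Req_dec t' t) as [->|Hn]; [rewrite !Rminus_diag, Rabs_R0; lra|].
    repeat split; [apply C1 | apply C2 | apply C3]; (split; [split; [exact I | auto] | lra]). }
  destruct Q as (Q1 & Q2 & Q3). apply Rabs_def2 in Q1, Q2, Q3, Hr'.
  assert (v <= u + e).
  { apply Rnot_lt_le. intros Hn. unfold rho_chart in *.
    pose proof (abel_lt p p_cont p_pos (a t') (u + e) v ltac:(lra) ltac:(lra) ltac:(lra)). lra. }
  assert (u - e <= v).
  { apply Rnot_lt_le. intros Hn. unfold rho_chart in *.
    pose proof (abel_lt p p_cont p_pos (a t') v (u - e) ltac:(lra) ltac:(lra) ltac:(lra)). lra. }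
  apply Rabs_def1; lra.
Qed.

Lemma chart_C1 (t r : R) : chart_range t r ->
  differentiable_pt_lim (fun t r => gtt_chart t (U t r)) t r
    (gtt_t t (U t r) - gtt_rho t (U t r) * rho_t t (U t r)) (gtt_rho t (U t r)) /\
  continuity_2d_pt (fun t r => gtt_t t (U t r) - gtt_rho t (U t r) * rho_t t (U t r)) t r /\
  continuity_2d_pt (fun t r => gtt_rho t (U t r)) t r.
Proof.
  intros Htr. destruct (U_spec t r Htr) as [Hu Eu]. pose proof (proj1 Htr) as Ht.
  pose proof (continuity_2d_pt_U t r Htr) as CU.
  assert (Cf : forall f, continuity_2d_pt f t (U t r) ->
    continuity_2d_pt (fun t r => f t (U t r)) t r).
  { intros f Hf. apply (continuity_2d_pt_comp2 f (fun t _ => t) U); cont2. }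
  pose proof (Cf _ (continuity_2d_pt_gtt_rho t _ Ht Hu)).
  pose proof (Cf _ (continuity_2d_pt_gtt_t t _ Ht Hu)).
  pose proof (Cf _ (continuity_2d_pt_rho_t t _ Ht Hu)).
  split; [|split; cont2].
  apply (differentiable_through_chart gtt_chart rho_chart gtt_rho
    (fun t u => - (p u / sqrt (a t ^ 2 - u ^ 2))) U).
  - assert (C : continuity_2d_pt (fun t u => a t - Rabs u) t (U t r)).
    { cont2. apply continuity_2d_pt_fst. eapply continuity_pt_of_is_derive. now apply a_deriv. }
    assert (He : 0 < a t - Rabs (U t r)) by lra.
    destruct (C (mkposreal _ He)) as [d Hd]. simpl in Hd.
    assert (Hd' : 0 < Rmin d t) by (apply Rmin_glb_lt; [apply cond_pos | auto]).
    exists (mkposreal _ Hd'). simpl. intros t' u' H1' H2'.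
    pose proof (Rmin_l d t). pose proof (Rmin_r d t).
    specialize (Hd t' u' ltac:(lra) ltac:(lra)). apply Rabs_def2 in Hd.
    apply Rabs_def2 in H1'.
    assert (Ht' : 0 < t') by lra. assert (Hu' : Rabs u' < a t') by lra.
    split; [now apply is_derive_gtt_u|]. split; [now apply is_derive_rho_u|].
    assert (0 <= p u') by (destruct (Req_dec u' 0) as [->|]; [rewrite p_0; lra | left; auto]).
    assert (0 <= p u' / sqrt (a t' ^ 2 - u' ^ 2)); [|cbv beta; rewrite <- Ropp_0; apply Ropp_le_contravar; assumption].
    apply Rmult_le_pos; auto. left. now apply Rinv_0_lt_compat, sqrt_gap_pos.
  - now apply continuity_2d_pt_gtt_rho.
  - now apply is_derive_gtt_t.
  - now apply is_derive_rho_t.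
  - generalize (chart_range_open t r Htr). apply locally_2d_impl, locally_2d_forall.
    intros t' r' H'. now apply U_spec.
  - exact CU.
Qed.

End Chart.

(** * Improper integrals evaluated by primitives *)

(** All improper integrals of the theorem are computed this way: finite one-sided limits of a
    primitive give convergence and value together, although the integrands blow up at [hi]. *)
Lemma iint_primitive (f F : R -> R) (lo hi l1 l2 : R) : lo < hi ->
  (forall t, lo < t < hi -> is_derive F t (f t) /\ continuity_pt f t) ->
  filterlim F (at_right lo) (locally l1) -> filterlim F (at_left hi) (locally l2) ->
  iint f lo hi = l2 - l1.
Proof.
  intros Hlh H H1 H2. unfold iint.
  assert (Hd : 0 < hi - lo) by lra.
  assert (P1 : at_right lo (fun x => lo < x < hi)).
  { exists (mkposreal _ Hd). intros y Hy Hlt. change (Rabs (y - lo) < hi - lo) in Hy.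
    apply Rabs_def2 in Hy. lra. }
  assert (P2 : at_left hi (fun x => lo < x < hi)).
  { exists (mkposreal _ Hd). intros y Hy Hlt. change (Rabs (y - hi) < hi - lo) in Hy.
    apply Rabs_def2 in Hy. lra. }
  assert (Hmm : forall x y z, lo < x < hi -> lo < y < hi -> Rmin x y <= z <= Rmax x y -> lo < z < hi).
  { intros x y z. unfold Rmin, Rmax. destruct (Rle_dec x y); lra. }
  apply (is_RInt_gen_unique (V := R_CompleteNormedModule)).
  apply (is_RInt_gen_ext (V := R_NormedModule) (Derive F) f).
  - apply (Filter_prod _ _ _ _ _ P1 P2). intros x y Hx Hy z Hz. simpl in Hz.
    apply is_derive_unique. apply H. apply (Hmm x y); auto. lra.
  - apply (is_RInt_gen_Derive F l1 l2); auto.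
    + apply (Filter_prod _ _ _ _ _ P1 P2). intros x y Hx Hy z Hz. simpl in Hz.
      exists (f z). apply H. now apply (Hmm x y).
    + apply (Filter_prod _ _ _ _ _ P1 P2). intros x y Hx Hy z Hz. simpl in Hz.
      assert (Hz' : lo < z < hi) by now apply (Hmm x y).
      apply (continuous_ext_loc (Derive F) f z).
      * assert (Hr : 0 < Rmin (z - lo) (hi - z)) by (apply Rmin_glb_lt; lra).
        exists (mkposreal _ Hr). intros t Ht. change (Rabs (t - z) < Rmin (z - lo) (hi - z)) in Ht.
        pose proof (Rmin_l (z - lo) (hi - z)). pose proof (Rmin_r (z - lo) (hi - z)).
        apply Rabs_def2 in Ht. symmetry. apply is_derive_unique, H. lra.
      * apply continuity_pt_filterlim. now apply H.
Qed.

Lemma filterlim_at_right_of_continuity (F : R -> R) (x : R) :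
  continuity_pt F x -> filterlim F (at_right x) (locally (F x)).
Proof.
  intros H. apply continuity_pt_filterlim in H.
  eapply filterlim_filter_le_1; [|exact H]. apply filter_le_within.
Qed.

Lemma filterlim_at_left_of_continuity (F : R -> R) (x : R) :
  continuity_pt F x -> filterlim F (at_left x) (locally (F x)).
Proof.
  intros H. apply continuity_pt_filterlim in H.
  eapply filterlim_filter_le_1; [|exact H]. apply filter_le_within.
Qed.

(** * The integrals of a strongly regular scale factor *)

Section ScaleFactor.
Variables a ad ad2 ad3 : R -> R.
Variables K0 C0 L : R.
Hypothesis a_0 : a 0 = 0.
Hypothesis a_lt : forall s t, 0 <= s -> s < t -> a s < a t.
Hypothesis a_surj : forall y, 0 <= y -> exists t, 0 <= t /\ a t = y.
Hypothesis a_cont : forall t, 0 <= t -> continuity_pt a t.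
Hypothesis a_even : forall t, a (- t) = a t.
Hypothesis ad_pos : forall t, 0 < t -> 0 < ad t.
Hypothesis a_deriv : forall t, 0 < t -> is_derive a t (ad t).
Hypothesis ad_deriv : forall t, 0 < t -> is_derive ad t (ad2 t).
Hypothesis ad2_deriv : forall t, 0 < t -> is_derive ad2 t (ad3 t).
Hypothesis K0_ge1 : 1 <= K0.
Hypothesis q_bounds : forall t, 0 < t -> - K0 <= a t * ad2 t / ad t ^ 2 <= 1.
Hypothesis ad3_bound : forall t, 0 < t -> Rabs (ad3 t * a t ^ 2 / ad t ^ 3) <= C0.
Hypothesis ad_lim : forall e, 0 < e -> exists d, 0 < d /\ forall t, 0 < t < d -> Rabs (ad t - L) < e.
Hypothesis pt_lim : forall e, 0 < e -> exists d, 0 < d /\ forall t, 0 < t < d -> a t / ad t < e.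

Lemma a_pos (t : R) : 0 < t -> 0 < a t.
Proof. intros Ht. rewrite <- a_0. apply a_lt; lra. Qed.

Lemma a_nonneg (t : R) : 0 <= a t.
Proof.
  destruct (Rtotal_order t 0) as [H|[->|H]]; [|lra|left; now apply a_pos].
  rewrite <- (Ropp_involutive t), a_even. left. apply a_pos. lra.
Qed.

Lemma a_lt_inv (s t : R) : 0 <= t -> 0 <= s -> a s < a t -> s < t.
Proof.
  intros Ht Hs H. apply Rnot_le_lt. intros [Hn|<-]; [|lra].
  pose proof (a_lt t s Ht Hn). lra.
Qed.

Definition a_inv (u : R) : R := epsilon (inhabits 0) (fun t => 0 <= t /\ a t = u).

Lemma a_inv_spec (u : R) : 0 <= u -> 0 <= a_inv u /\ a (a_inv u) = u.
Proof. intros Hu. apply (epsilon_spec (inhabits 0) (fun t => 0 <= t /\ a t = u)).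
  now apply a_surj. Qed.

Lemma a_inv_a (t : R) : 0 <= t -> a_inv (a t) = t.
Proof.
  intros Ht. destruct (a_inv_spec (a t) (a_nonneg t)) as [H E].
  destruct (Rtotal_order (a_inv (a t)) t) as [Hl|[He|Hg]]; auto.
  - pose proof (a_lt _ _ H Hl). lra.
  - pose proof (a_lt _ _ Ht Hg). lra.
Qed.

Lemma a_inv_0 : a_inv 0 = 0.
Proof. rewrite <- a_0 at 1. apply a_inv_a. lra. Qed.

Lemma a_inv_pos (u : R) : 0 < u -> 0 < a_inv u.
Proof.
  intros Hu. destruct (a_inv_spec u) as [[H|H] E]; [lra|auto|].
  rewrite <- H, a_0 in E. lra.
Qed.

Lemma a_inv_continuous (u0 e : R) : 0 <= u0 -> 0 < e ->
  exists d, 0 < d /\ forall u, 0 <= u -> Rabs (u - u0) < d -> Rabs (a_inv u - a_inv u0) < e.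
Proof.
  intros Hu0 He. destruct (a_inv_spec u0 Hu0) as [H E]. set (t0 := a_inv u0) in *.
  assert (Hup : u0 < a (t0 + e)) by (rewrite <- E; apply a_lt; lra).
  assert (Hlo : exists d, 0 < d /\ forall u, 0 <= u -> u0 - u < d -> t0 - e < a_inv u).
  { destruct (Rle_dec 0 (t0 - e)) as [Hle|Hle].
    - exists (u0 - a (t0 - e)). split.
      + rewrite <- E. pose proof (a_lt (t0 - e) t0 Hle). lra.
      + intros u Hu Hdu. destruct (a_inv_spec u Hu) as [Hb1 E1].
        apply a_lt_inv; auto. rewrite E1. lra.
    - exists 1. split; [lra|]. intros u Hu _. destruct (a_inv_spec u Hu). lra. }
  destruct Hlo as [d [Hd Hlo]].
  exists (Rmin d (a (t0 + e) - u0)). split; [apply Rmin_glb_lt; lra|].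
  intros u Hu Hdu. pose proof (Rmin_l d (a (t0 + e) - u0)). pose proof (Rmin_r d (a (t0 + e) - u0)).
  apply Rabs_def2 in Hdu. destruct (a_inv_spec u Hu) as [Hb1 E1].
  specialize (Hlo u Hu ltac:(lra)).
  assert (a_inv u < t0 + e) by (apply a_lt_inv; try lra).
  apply Rabs_def1; lra.
Qed.

Lemma a_inv_lt (u v : R) : 0 <= u -> u < v -> a_inv u < a_inv v.
Proof.
  intros Hu Huv. destruct (a_inv_spec u Hu), (a_inv_spec v ltac:(lra)).
  apply a_lt_inv; auto. lra.
Qed.

Lemma is_derive_a_inv (u : R) : 0 < u -> is_derive a_inv u (/ ad (a_inv u)).
Proof.
  intros Hu. pose proof (a_inv_pos u Hu) as Hb. pose proof (ad_pos _ Hb).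
  assert (Prf : forall x, a_inv (u / 2) <= x <= a_inv (2 * u) -> derivable_pt a x).
  { intros x Hx. exists (ad x). apply is_derive_Reals, a_deriv.
    pose proof (a_inv_pos (u / 2)). lra. }
  assert (Cb : continuity_pt a_inv u).
  { intros e He. destruct (a_inv_continuous u e ltac:(lra) He) as [d [Hd Hc]].
    exists (Rmin d u). split; [now apply Rmin_glb_lt|]. intros x [_ Hx].
    simpl in *. unfold Rdist in *. pose proof (Rmin_l d u). pose proof (Rmin_r d u).
    apply Hc; [apply Rabs_def2 in Hx; lra | lra]. }
  assert (Hin : a_inv (u / 2) <= a_inv u <= a_inv (2 * u)).
  { pose proof (a_inv_lt (u / 2) u). pose proof (a_inv_lt u (2 * u)). lra. }
  assert (Ed : derive_pt a (a_inv u) (Prf (a_inv u) Hin) = ad (a_inv u)).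
  { apply derive_pt_eq_0. apply is_derive_Reals, a_deriv. auto. }
  pose proof (derivable_pt_lim_recip_interv a a_inv (u / 2) (2 * u) u Prf Cb) as D.
  specialize (D ltac:(lra) ltac:(lra) Hin). rewrite Ed in D.
  replace (/ ad (a_inv u)) with (1 / ad (a_inv u)) by (unfold Rdiv; ring).
  apply is_derive_Reals. apply D; [|lra].
  intros x Hx. unfold comp, id. apply a_inv_spec. lra.
Qed.

(** Carries a function of time [t > 0] to the coordinate [u = signed_a t], as an even function. The
    value at [u = 0] is prescribed separately because [g] is typically a quotient by [adot], about
    which nothing is known at time [0] except through limits. *)
Definition pull (g : R -> R) (c u : R) : R := if Req_EM_T u 0 then c else g (a_inv (Rabs u)).

Lemma pull_pos (g : R -> R) (c u : R) : 0 < u -> pull g c u = g (a_inv u).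
Proof. intros Hu. unfold pull. destruct (Req_EM_T u 0); [lra|]. now rewrite Rabs_right by lra. Qed.

Lemma pull_a (g : R -> R) (c t : R) : 0 < t -> pull g c (a t) = g t.
Proof. intros Ht. rewrite pull_pos by now apply a_pos. rewrite a_inv_a; auto; lra. Qed.

Lemma pull_0 (g : R -> R) (c : R) : pull g c 0 = c.
Proof. unfold pull. destruct (Req_EM_T 0 0); lra. Qed.

Lemma pull_even (g : R -> R) (c u : R) : pull g c (- u) = pull g c u.
Proof.
  unfold pull. rewrite Rabs_Ropp.
  destruct (Req_EM_T u 0), (Req_EM_T (- u) 0); auto; lra.
Qed.

Lemma pull_continuity (g : R -> R) (c : R) :
  (forall t, 0 < t -> continuity_pt g t) ->
  (forall e, 0 < e -> exists d, 0 < d /\ forall t, 0 < t < d -> Rabs (g t - c) < e) ->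
  forall u, continuity_pt (pull g c) u.
Proof.
  intros Hg Hc u e He. pose proof (Rabs_pos u) as Hu0.
  assert (Tri : forall x, Rabs (Rabs x - Rabs u) <= Rabs (x - u)) by (intros; apply Rabs_triang_inv2).
  destruct (Req_dec u 0) as [->|Hu].
  - destruct (Hc e He) as [d [Hd H]]. destruct (a_inv_continuous 0 d ltac:(lra) Hd) as [r [Hr Hb]].
    exists r. split; auto. intros x [[_ Hn] Hx]. simpl in *. unfold Rdist in *.
    rewrite pull_0. unfold pull. destruct (Req_EM_T x 0); [congruence|].
    assert (0 < Rabs x) by now apply Rabs_pos_lt.
    apply H. split; [now apply a_inv_pos|].
    rewrite Rminus_0_r in Hx. specialize (Hb (Rabs x) ltac:(lra)).
    rewrite a_inv_0, !Rminus_0_r, Rabs_Rabsolu in Hb. specialize (Hb Hx).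
    apply Rabs_def2 in Hb. lra.
  - assert (Hp : 0 < Rabs u) by now apply Rabs_pos_lt.
    destruct (Hg (a_inv (Rabs u)) (a_inv_pos _ Hp) e He) as [d [Hd H]].
    destruct (a_inv_continuous (Rabs u) d ltac:(lra) Hd) as [r [Hr Hb]].
    exists (Rmin r (Rabs u)). split; [now apply Rmin_glb_lt|].
    intros x [_ Hx]. simpl in *. unfold Rdist in *.
    pose proof (Rmin_l r (Rabs u)). pose proof (Rmin_r r (Rabs u)).
    assert (Hx0 : x <> 0).
    { intros ->. specialize (Tri 0). rewrite Rminus_0_l, Rabs_Ropp in Hx. lra. }
    unfold pull. destruct (Req_EM_T x 0); [lra|]. destruct (Req_EM_T u 0); [lra|].
    assert (Hbx : Rabs (a_inv (Rabs x) - a_inv (Rabs u)) < d).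
    { apply Hb; [apply Rabs_pos|]. specialize (Tri x). lra. }
    destruct (Req_dec (a_inv (Rabs x)) (a_inv (Rabs u))) as [->|Hn].
    + rewrite Rminus_diag, Rabs_R0. lra.
    + apply H. split; [split; [exact I | auto] | exact Hbx].
Qed.

Lemma is_derive_pull (g : R -> R) (c u m : R) : 0 < u -> is_derive g (a_inv u) m ->
  is_derive (pull g c) u (/ ad (a_inv u) * m).
Proof.
  intros Hu H. apply (is_derive_ext_loc (fun u => g (a_inv u))).
  - exists (mkposreal u Hu). intros x Hx. change (Rabs (x - u) < u) in Hx.
    apply Rabs_def2 in Hx. symmetry. apply pull_pos. lra.
  - apply (is_derive_comp g a_inv); auto. now apply is_derive_a_inv.
Qed.

(** The slope in [u] is [dg / ad]. A global bound on [dg] suffices, since [/ ad] is continuous and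
    hence bounded, by its value plus [1], near each positive argument. *)
Lemma pull_lipschitz (g dg : R -> R) (c M : R) : 0 <= M ->
  (forall t, 0 < t -> is_derive g t (dg t) /\ Rabs (dg t) <= M) ->
  locally_lipschitz_on_pos (pull g c).
Proof.
  intros HM Hg A HA. pose proof (a_inv_pos A HA) as HbA. pose proof (ad_pos _ HbA) as Had.
  assert (Cont : continuity_pt (fun x => / ad (a_inv x)) A).
  { apply continuity_pt_inv; [|lra]. apply (continuity_pt_comp a_inv ad).
    - eapply continuity_pt_of_is_derive. now apply is_derive_a_inv.
    - eapply continuity_pt_of_is_derive. now apply ad_deriv. }
  destruct (Cont 1 Rlt_0_1) as [d [Hd H]]. simpl in H. unfold Rdist in H.
  set (B := / ad (a_inv A) + 1).
  assert (HB : 0 < B) by (unfold B; pose proof (Rinv_0_lt_compat _ Had); lra).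
  exists (Rmin d A), (M * B). split; [now apply Rmin_glb_lt|]. split; [nra|].
  intros x y Hx Hy. pose proof (Rmin_l d A). pose proof (Rmin_r d A).
  apply Rabs_def2 in Hx, Hy.
  apply (lipschitz_of_derive (pull g c) (fun u => / ad (a_inv u) * dg (a_inv u)) (M * B) y x).
  intros t Ht.
  assert (Ht' : A - Rmin d A < t < A + Rmin d A)
    by (unfold Rmin at 1 in Ht; unfold Rmax in Ht; destruct (Rle_dec y x); lra).
  assert (Ht0 : 0 < t) by lra. pose proof (a_inv_pos t Ht0) as Hbt.
  destruct (Hg _ Hbt) as [G1 G2]. split; [now apply is_derive_pull|].
  pose proof (Rinv_0_lt_compat _ (ad_pos _ Hbt)) as Hi.
  rewrite Rabs_mult, (Rabs_right (/ _)) by lra.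
  assert (/ ad (a_inv t) <= B).
  { unfold B. destruct (Req_dec t A) as [->|Hn]; [lra|].
    assert (Q : Rabs (/ ad (a_inv t) - / ad (a_inv A)) < 1).
    { apply H. split; [split; [exact I | auto]|]. apply Rabs_def1; lra. }
    apply Rabs_def2 in Q. lra. }
  pose proof (Rabs_pos (dg (a_inv t))). nra.
Qed.

Definition accel_ratio (t : R) : R := a t * ad2 t / ad t ^ 2.
Definition hubble_radius : R -> R := pull (fun t => a t / ad t) 0.
(** With [p = a / adot] one has [dp/dt = 1 - accel_ratio] and [dv = adot dt], which makes this
    [v dp/dv]. *)
Definition hubble_slope : R -> R := pull (fun t => a t / ad t * (1 - accel_ratio t)) 0.
(** Plays the role of [l] in the chart. Its continuity at [0] is exactly the convergence of [adot]
    to the finite limit [L]. *)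
Definition expansion_rate : R -> R := pull ad L.

Lemma is_derive_pt (t : R) : 0 < t -> is_derive (fun t => a t / ad t) t (1 - accel_ratio t).
Proof.
  intros Ht. pose proof (a_deriv t Ht) as H1. pose proof (ad_deriv t Ht) as H2.
  pose proof (ad_pos t Ht). unfold accel_ratio.
  auto_derive; [repeat split; try (eexists; eassumption); lra|].
  replace (Derive (fun x => a x) t) with (ad t) by (symmetry; now apply is_derive_unique).
  replace (Derive (fun x => ad x) t) with (ad2 t) by (symmetry; now apply is_derive_unique).
  field. lra.
Qed.

(** The third derivative occurs only in the scale-free combination that the hypothesis bounds, and
    the other terms are polynomial in the bounded [accel_ratio]. *)
Lemma is_derive_wt (t : R) : 0 < t -> is_derive (fun t => a t / ad t * (1 - accel_ratio t)) t
  (1 - 3 * accel_ratio t + 3 * accel_ratio t ^ 2 - ad3 t * a t ^ 2 / ad t ^ 3).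
Proof.
  intros Ht. pose proof (a_deriv t Ht) as H1. pose proof (ad_deriv t Ht) as H2.
  pose proof (ad2_deriv t Ht) as H3. pose proof (ad_pos t Ht). unfold accel_ratio.
  auto_derive.
  - repeat split; try (eexists; eassumption); try lra. rewrite Rmult_1_r. nra.
  - replace (Derive (fun x => a x) t) with (ad t) by (symmetry; now apply is_derive_unique).
    replace (Derive (fun x => ad x) t) with (ad2 t) by (symmetry; now apply is_derive_unique).
    replace (Derive (fun x => ad2 x) t) with (ad3 t) by (symmetry; now apply is_derive_unique).
    field. lra.
Qed.

Lemma hubble_ratio_pos (t : R) : 0 < t -> 0 < a t / ad t.
Proof. intros Ht. apply Rdiv_lt_0_compat; auto. now apply a_pos. Qed.

Lemma hubble_radius_cont (u : R) : continuity_pt hubble_radius u.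
Proof.
  apply pull_continuity.
  - intros t Ht. eapply continuity_pt_of_is_derive. now apply is_derive_pt.
  - intros e He. destruct (pt_lim e He) as [d [Hd H]]. exists d. split; auto.
    intros t Ht. rewrite Rminus_0_r, Rabs_right; [auto|].
    apply Rle_ge. left. apply hubble_ratio_pos. lra.
Qed.

Lemma hubble_slope_cont (u : R) : continuity_pt hubble_slope u.
Proof.
  apply pull_continuity.
  - intros t Ht. eapply continuity_pt_of_is_derive. now apply is_derive_wt.
  (* The factor [1 - accel_ratio] lies between [0] and [1 + K0], so [hubble_slope] vanishes at [0]
     along with the Hubble radius. *)
  - intros e He. destruct (pt_lim (e / (1 + K0))) as [d [Hd H]].
    { apply Rdiv_lt_0_compat; lra. }
    exists d. split; auto. intros t Ht. specialize (H t Ht).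
    pose proof (hubble_ratio_pos t ltac:(lra)). pose proof (q_bounds t ltac:(lra)). fold (accel_ratio t) in *.
    assert (a t / ad t * (1 + K0) < e).
    { replace e with (e / (1 + K0) * (1 + K0)) by (field; lra).
      apply Rmult_lt_compat_r; lra. }
    rewrite Rminus_0_r, Rabs_right; nra.
Qed.

Lemma expansion_rate_cont (u : R) : continuity_pt expansion_rate u.
Proof.
  apply pull_continuity; auto.
  intros t Ht. eapply continuity_pt_of_is_derive. now apply ad_deriv.
Qed.

Lemma hubble_radius_pos (u : R) : u <> 0 -> 0 < hubble_radius u.
Proof.
  intros Hu. unfold hubble_radius, pull. destruct (Req_EM_T u 0); [lra|].
  apply hubble_ratio_pos, a_inv_pos, Rabs_pos_lt, Hu.
Qed.

(** This is condition (c) of a regular scale factor. It makes [chi_reg A] nondecreasing on the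
    positive axis, which the estimate of the areal radius near [u = 0] relies on. *)
Lemma hubble_slope_nonneg (u : R) : 0 <= hubble_slope u.
Proof.
  unfold hubble_slope, pull. destruct (Req_EM_T u 0) as [|Hu]; [lra|].
  assert (Hb : 0 < a_inv (Rabs u)) by (apply a_inv_pos, Rabs_pos_lt, Hu).
  pose proof (hubble_ratio_pos _ Hb). pose proof (q_bounds _ Hb). fold (accel_ratio (a_inv (Rabs u))) in *.
  apply Rmult_le_pos; lra.
Qed.

Lemma hubble_radius_rate (u : R) : hubble_radius u * expansion_rate u = Rabs u.
Proof.
  unfold hubble_radius, expansion_rate, pull. destruct (Req_EM_T u 0) as [->|Hu]; [rewrite Rabs_R0; ring|].
  assert (Hp : 0 < Rabs u) by now apply Rabs_pos_lt.
  pose proof (ad_pos _ (a_inv_pos _ Hp)). destruct (a_inv_spec (Rabs u) ltac:(lra)) as [_ E].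
  rewrite E. field. lra.
Qed.

(** For [u > 0] this is the product rule, and evenness transfers it to [u < 0]. At [u = 0] the
    Hubble radius may fail to be differentiable (for [a t = t^2] it is a multiple of [sqrt u]), but
    [u] times a continuous function vanishing there has derivative [0]. *)
Lemma is_derive_id_mul_hubble_radius (u : R) : is_derive (fun u => u * hubble_radius u) u (hubble_radius u + hubble_slope u).
Proof.
  assert (Pos : forall u, 0 < u -> is_derive (fun u => u * hubble_radius u) u (hubble_radius u + hubble_slope u)).
  { clear u. intros u Hu. pose proof (a_inv_pos u Hu) as Hb. pose proof (ad_pos _ Hb).
    replace (hubble_radius u + hubble_slope u) with (plus (mult 1 (hubble_radius u)) (mult u (/ ad (a_inv u) * (1 - accel_ratio (a_inv u))))).
    - apply (is_derive_mult (fun u => u) hubble_radius); [apply (is_derive_id u) | | intros; apply Rmult_comm].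
      apply is_derive_pull; auto. now apply is_derive_pt.
    - change (1 * hubble_radius u + u * (/ ad (a_inv u) * (1 - accel_ratio (a_inv u))) = hubble_radius u + hubble_slope u).
      unfold hubble_slope. rewrite (pull_pos _ _ u Hu). destruct (a_inv_spec u ltac:(lra)) as [_ E].
      rewrite E. field. lra. }
  destruct (Rtotal_order u 0) as [Hu|[->|Hu]]; [| |now apply Pos].
  - assert (Hu' : 0 < - u) by lra.
    replace (hubble_radius u + hubble_slope u) with (opp (-1 * (hubble_radius (- u) + hubble_slope (- u)))).
    + apply (is_derive_ext (fun u => opp (- u * hubble_radius (- u)))).
      * intros t. change (- (- t * hubble_radius (- t)) = t * hubble_radius t). unfold hubble_radius. rewrite pull_even. ring.
      * apply (is_derive_opp (fun u => - u * hubble_radius (- u))).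
        apply (is_derive_comp (fun u => u * hubble_radius u) (fun u => - u)); [now apply Pos|].
        auto_derive; auto.
    + change (- (-1 * (hubble_radius (- u) + hubble_slope (- u))) = hubble_radius u + hubble_slope u). unfold hubble_radius, hubble_slope. rewrite !pull_even. ring.
  - replace (hubble_radius 0 + hubble_slope 0) with 0 by (unfold hubble_radius, hubble_slope; rewrite !pull_0; ring).
    apply is_derive_of_estimate. intros e He. destruct (hubble_radius_cont 0 e He) as [d [Hd H]].
    simpl in H. unfold Rdist in H.
    exists d. split; auto. intros t Ht.
    replace (t * hubble_radius t - 0 * hubble_radius 0 - 0 * (t - 0)) with ((t - 0) * hubble_radius t) by ring.
    rewrite Rabs_mult, Rmult_comm. apply Rmult_le_compat_r; [apply Rabs_pos|].
    destruct (Req_dec t 0) as [->|Hn]; [unfold hubble_radius; rewrite pull_0, Rabs_R0; lra|].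
    left. replace (hubble_radius t) with (hubble_radius t - hubble_radius 0) by (unfold hubble_radius at 2; rewrite pull_0; ring).
    apply H. split; [split; [exact I | auto] | exact Ht].
Qed.

Lemma hubble_radius_lipschitz : locally_lipschitz_on_pos hubble_radius.
Proof.
  apply (pull_lipschitz _ (fun t => 1 - accel_ratio t) 0 (1 + K0)); [lra|].
  intros t Ht. split; [now apply is_derive_pt|].
  pose proof (q_bounds t Ht). fold (accel_ratio t) in *. apply Rabs_le. lra.
Qed.

Lemma hubble_slope_lipschitz : locally_lipschitz_on_pos hubble_slope.
Proof.
  assert (0 <= C0) by (eapply Rle_trans; [apply Rabs_pos | apply (ad3_bound 1); lra]).
  apply (pull_lipschitz _ (fun t => 1 - 3 * accel_ratio t + 3 * accel_ratio t ^ 2 - ad3 t * a t ^ 2 / ad t ^ 3) 0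
    (* Term by term from [is_derive_wt]: because [1 <= K0], the two bounds on the ratio combine into
       [|accel_ratio| <= K0]. *)
    (1 + 3 * K0 + 3 * K0 ^ 2 + C0)); [nra|].
  intros t Ht. split; [now apply is_derive_wt|].
  pose proof (q_bounds t Ht). fold (accel_ratio t) in *.
  pose proof (ad3_bound t Ht) as H3. apply Rabs_le_between in H3.
  apply Rabs_le. nra.
Qed.

Definition signed_a (t : R) : R := if Rle_dec 0 t then a t else - a t.

Lemma signed_a_nonneg (t : R) : 0 <= t -> signed_a t = a t.
Proof. intros H. unfold signed_a. destruct (Rle_dec 0 t); [reflexivity | lra]. Qed.

Lemma signed_a_neg (t : R) : t < 0 -> signed_a t = - a t.
Proof. intros H. unfold signed_a. destruct (Rle_dec 0 t); [lra | reflexivity]. Qed.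

Lemma a_Rabs (t : R) : a (Rabs t) = a t.
Proof. unfold Rabs. destruct (Rcase_abs t); auto. Qed.

Lemma Rabs_signed_a (t : R) : Rabs (signed_a t) = a t.
Proof.
  pose proof (a_nonneg t). unfold signed_a. destruct (Rle_dec 0 t).
  - apply Rabs_right. lra.
  - rewrite Rabs_Ropp. apply Rabs_right. lra.
Qed.

Lemma signed_a_sq (t : R) : signed_a t ^ 2 = a t ^ 2.
Proof. unfold signed_a. destruct (Rle_dec 0 t); ring. Qed.

Lemma a_lt_of_Rabs (t T : R) : Rabs t < T -> a t < a T.
Proof. intros H. rewrite <- a_Rabs. apply a_lt; [apply Rabs_pos | exact H]. Qed.

Lemma a_continuity (t : R) : continuity_pt a t.
Proof.
  destruct (Rle_dec 0 t) as [H|H]; [now apply a_cont|].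
  assert (Ho : continuity_pt (comp a Ropp) t).
  { apply continuity_pt_comp; [apply continuity_pt_opp, derivable_continuous_pt, derivable_pt_id|].
    apply a_cont. unfold id. lra. }
  intros e He. destruct (Ho e He) as [d [Hd Hc]]. exists d. split; auto.
  intros x Hx. specialize (Hc x Hx). unfold comp in Hc. now rewrite !a_even in Hc.
Qed.

Lemma is_derive_signed_a (t : R) : t <> 0 -> is_derive signed_a t (ad (Rabs t)).
Proof.
  intros Ht. destruct (Rle_dec 0 t) as [H|H].
  - assert (Hp : 0 < t) by lra. rewrite Rabs_right by lra.
    apply (is_derive_ext_loc a); [|now apply a_deriv].
    exists (mkposreal t Hp). intros x Hx. change (Rabs (x - t) < t) in Hx.
    apply Rabs_def2 in Hx. symmetry. apply signed_a_nonneg. lra.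
  - assert (Hp : 0 < - t) by lra. rewrite Rabs_left by lra.
    apply (is_derive_ext_loc (fun t => opp (a (- t)))).
    + exists (mkposreal (- t) Hp). intros x Hx. change (Rabs (x - t) < - t) in Hx.
      apply Rabs_def2 in Hx. symmetry. rewrite a_even. apply signed_a_neg. lra.
    + replace (ad (- t)) with (opp (-1 * ad (- t))) by (unfold opp; simpl; ring).
      apply (is_derive_opp (fun t => a (- t))).
      apply (is_derive_comp a (fun t => - t)); [now apply a_deriv|]. auto_derive; auto.
Qed.

Lemma signed_a_continuity (t : R) : continuity_pt signed_a t.
Proof.
  destruct (Req_dec t 0) as [->|Ht].
  - intros e He. destruct (a_continuity 0 e He) as [d [Hd H]]. exists d. split; auto.
    intros x Hx. specialize (H x Hx). simpl in *. unfold Rdist in *.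
    rewrite (signed_a_nonneg 0), a_0, Rminus_0_r in * by lra. rewrite Rabs_signed_a.
    rewrite Rabs_right in H; [exact H|]. apply Rle_ge, a_nonneg.
  - eapply continuity_pt_of_is_derive. now apply is_derive_signed_a.
Qed.

Lemma filterlim_abel_a (g : R -> R) (tau : R) : (forall u, continuity_pt g u) -> 0 < tau ->
  filterlim (fun t => abel g (a tau) (signed_a t)) (at_left tau) (locally (abel_full g (a tau))).
Proof.
  intros Hg Ht P [e He].
  destruct (abel_near_full g Hg (a tau) e (a_pos _ Ht) (cond_pos e)) as [u1 [Hu1 H]].
  assert (Hd0 : 0 < a tau - u1) by lra.
  destruct (a_continuity tau _ Hd0) as [d [Hd Hc]]. simpl in Hc. unfold Rdist in Hc.
  assert (Hd' : 0 < Rmin d tau) by now apply Rmin_glb_lt.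
  exists (mkposreal _ Hd'). intros t Hball Hlt. apply He.
  change (Rabs (t - tau) < Rmin d tau) in Hball.
  pose proof (Rmin_l d tau). pose proof (Rmin_r d tau).
  change (Rabs (abel g (a tau) (signed_a t) - abel_full g (a tau)) < e).
  assert (Q : Rabs (a t - a tau) < a tau - u1).
  { apply Hc. split; [split; [exact I | lra] | lra]. }
  apply Rabs_def2 in Q, Hball. rewrite signed_a_nonneg by lra. apply H.
  split; [lra|]. apply a_lt; lra.
Qed.

Lemma is_derive_abel_signed_a (g : R -> R) (tau t : R) : (forall u, continuity_pt g u) ->
  Rabs t < tau -> t <> 0 ->
  is_derive (fun t => abel g (a tau) (signed_a t)) t
    (ad (Rabs t) * (g (signed_a t) / sqrt (a tau ^ 2 - a t ^ 2))).
Proof.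
  intros Hg Ht Hn. rewrite <- (signed_a_sq t).
  apply (is_derive_comp (abel g (a tau)) signed_a); [|now apply is_derive_signed_a].
  apply is_derive_abel_u; auto. rewrite Rabs_signed_a. now apply a_lt_of_Rabs.
Qed.

Lemma gap_pos (tau t : R) : Rabs t < tau -> 0 < sqrt (a tau ^ 2 - a t ^ 2).
Proof.
  intros H. rewrite <- (signed_a_sq t). apply sqrt_gap_pos. rewrite Rabs_signed_a. now apply a_lt_of_Rabs.
Qed.

Lemma gap_continuity (A t : R) : continuity_pt (fun t => sqrt (A ^ 2 - a t ^ 2)) t.
Proof.
  apply (continuity_2d_pt_slice2 (fun (_ : R) t => sqrt (A ^ 2 - a t ^ 2)) 0).
  cont2; apply continuity_2d_pt_snd, a_continuity.
Qed.

(** The substitution [v = signed_a t] turns [a dt] into [hubble_radius v dv], for negative times as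
    well, since the Hubble radius is even. *)
Lemma rho_integral (tau t0 : R) : 0 < tau -> - tau < t0 < tau ->
  rho_of a tau t0 = abel_full hubble_radius (a tau) - abel hubble_radius (a tau) (signed_a t0).
Proof.
  intros Ht H0. unfold rho_of.
  set (f := fun t => a t / sqrt (a tau ^ 2 - a t ^ 2)).
  assert (Cf : forall t, Rabs t < tau -> continuity_pt f t).
  { intros t H. pose proof (gap_pos tau t H). unfold f, Rdiv.
    apply continuity_pt_mult; [apply a_continuity|].
    apply continuity_pt_inv; [apply gap_continuity | lra]. }
  assert (CF : forall t, Rabs t < tau -> continuity_pt (fun t => abel hubble_radius (a tau) (signed_a t)) t).
  { intros t H. apply (continuity_pt_comp signed_a (abel hubble_radius (a tau))); [apply signed_a_continuity|].
    eapply continuity_pt_of_is_derive, is_derive_abel_u; [exact hubble_radius_cont|].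
    rewrite Rabs_signed_a. now apply a_lt_of_Rabs. }
  assert (Dn : forall t, Rabs t < tau -> t <> 0 -> is_derive (fun t => abel hubble_radius (a tau) (signed_a t)) t (f t)).
  { intros t H Hn. replace (f t) with (ad (Rabs t) * (hubble_radius (signed_a t) / sqrt (a tau ^ 2 - a t ^ 2))).
    - apply is_derive_abel_signed_a; auto. exact hubble_radius_cont.
    - assert (Hp : 0 < Rabs t) by now apply Rabs_pos_lt.
      pose proof (gap_pos tau t H). pose proof (ad_pos _ Hp).
      replace (hubble_radius (signed_a t)) with (a t / ad (Rabs t)).
      + unfold f. field. lra.
      + unfold hubble_radius, pull. destruct (Req_EM_T (signed_a t) 0) as [E|E].
        * pose proof (Rabs_signed_a t) as E1. rewrite E, Rabs_R0, <- a_Rabs in E1.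
          pose proof (a_pos _ Hp). lra.
        * rewrite Rabs_signed_a, <- a_Rabs, a_inv_a by lra. reflexivity. }
  apply (iint_primitive f (fun t => abel hubble_radius (a tau) (signed_a t))); [lra | | |].
  - intros t Hlt. assert (H : Rabs t < tau) by (apply Rabs_def1; lra). split; auto.
    (* The substitution is differentiable by hypothesis only for [t <> 0]. The integrand is
       continuous at [0], so [is_derive_punctured] fills in the point. *)
    destruct (Req_dec t 0) as [->|Hn]; auto.
    apply (is_derive_punctured (fun t => abel hubble_radius (a tau) (signed_a t)) f 0 tau); auto.
    intros t [H1 H2]. rewrite Rminus_0_r in *. apply Dn; auto. intros ->. rewrite Rabs_R0 in H1. lra.
  - apply (filterlim_at_right_of_continuity (fun t => abel hubble_radius (a tau) (signed_a t))), CF, Rabs_def1; lra.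
  - apply filterlim_abel_a; auto. exact hubble_radius_cont.
Qed.

Lemma hubble_radius_sg (t : R) : 0 < t -> hubble_radius (signed_a t) = a t / ad t.
Proof. intros Ht. rewrite signed_a_nonneg by lra. exact (pull_a (fun t => a t / ad t) 0 t Ht). Qed.

Lemma hubble_slope_sg (t : R) : 0 < t -> hubble_slope (signed_a t) = a t / ad t * (1 - accel_ratio t).
Proof. intros Ht. rewrite signed_a_nonneg by lra. exact (pull_a (fun t => a t / ad t * (1 - accel_ratio t)) 0 t Ht). Qed.

Lemma is_derive_gap (tau t : R) : 0 < t < tau ->
  is_derive (fun t => sqrt (a tau ^ 2 - a t ^ 2)) t
    (- (a t * ad t) / sqrt (a tau ^ 2 - a t ^ 2)).
Proof.
  intros Ht. assert (H : Rabs t < tau) by (rewrite Rabs_right; lra).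
  pose proof (gap_pos tau t H) as Hc. pose proof (a_deriv t ltac:(lra)) as D.
  assert (Hs : 0 < a tau ^ 2 - a t ^ 2).
  { pose proof (a_lt t tau ltac:(lra) ltac:(lra)). pose proof (a_pos t ltac:(lra)). nra. }
  auto_derive; replace (a tau * (a tau * 1) + - (a t * (a t * 1))) with (a tau ^ 2 - a t ^ 2) by ring.
  - split; auto. eexists; exact D.
  - replace (Derive (fun x => a x) t) with (ad t) by (symmetry; now apply is_derive_unique).
    field. lra.
Qed.

Lemma filterlim_minus_scal (F : (R -> Prop) -> Prop) (FF : Filter F) (f g : R -> R) (x y k : R) :
  filterlim f F (locally x) -> filterlim g F (locally y) ->
  filterlim (fun t => f t - k * g t) F (locally (x - k * y)).
Proof.
  intros Hf Hg. replace (x - k * y) with (plus x (scal (- k) y))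
    by (unfold plus, scal; simpl; unfold mult; simpl; ring).
  apply (filterlim_ext (fun t => plus (f t) (scal (- k) (g t)))).
  { intros t. unfold plus, scal; simpl; unfold mult; simpl. ring. }
  eapply (filterlim_comp_2 (f) (fun t => scal (- k) (g t)) plus); [exact Hf | |].
  - eapply filterlim_comp; [exact Hg|]. apply (filterlim_scal_r (V := R_NormedModule)).
  - apply (filterlim_plus (V := R_NormedModule)).
Qed.

(* On a slice [tau = const], [- h' (t) / c(t) = (- (h c)' - hubble_slope adot / c) / A^2] with
   [h = 1 / adot], [c = sqrt (A^2 - a^2)], [A = a tau]; integrating this gives the primitive. *)
Lemma f_integral (tau t0 : R) : 0 <= t0 < tau ->
  iint (fun t => ad2 t / ad t ^ 2 *
         (sqrt (a tau ^ 2 - a t0 ^ 2) / sqrt (a tau ^ 2 - a t ^ 2) - 1)) t0 tau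
  = (1 - ad tau * Psi hubble_radius hubble_slope (a tau) (a t0) / a tau ^ 2) / ad tau.
Proof.
  intros H0. assert (Ht : 0 < tau) by lra.
  set (A := a tau). set (c0 := sqrt (A ^ 2 - a t0 ^ 2)).
  set (c := fun t => sqrt (A ^ 2 - a t ^ 2)).
  set (Kt := fun t => abel hubble_slope A (signed_a t)).
  assert (HA : 0 < A) by now apply a_pos.
  assert (Ha0 : 0 <= a t0 < A) by (split; [apply a_nonneg | apply a_lt; lra]).
  assert (Hc0 : c0 ^ 2 = A ^ 2 - a t0 ^ 2) by (unfold c0; rewrite pow2_sqrt; nra).
  pose proof (ad_pos tau Ht) as Had.
  assert (CK : forall t, Rabs t < tau -> continuity_pt Kt t).
  { intros t H. apply (continuity_pt_comp signed_a (abel hubble_slope A)); [apply signed_a_continuity|].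
    eapply continuity_pt_of_is_derive, is_derive_abel_u; [exact hubble_slope_cont|].
    rewrite Rabs_signed_a. now apply a_lt_of_Rabs. }
  assert (DG : forall t, 0 < t < tau ->
    is_derive (fun t => / ad t * (1 - c0 * c t / A ^ 2) - c0 / A ^ 2 * Kt t) t
      (ad2 t / ad t ^ 2 * (c0 / c t - 1))).
  { intros t H. assert (Hr : Rabs t < tau) by (rewrite Rabs_right; lra).
    pose proof (gap_pos tau t Hr) as Hc. pose proof (ad_pos t ltac:(lra)) as Hd.
    pose proof (ad_deriv t ltac:(lra)) as D2. pose proof (is_derive_gap tau t H) as Dc.
    pose proof (is_derive_abel_signed_a hubble_slope tau t hubble_slope_cont Hr ltac:(lra)) as DK.
    rewrite Rabs_right, hubble_slope_sg in DK by lra.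
    fold A in Hc, Dc, DK. fold c in Dc. fold Kt in DK. change (0 < c t) in Hc.
    change (is_derive c t (- (a t * ad t) / c t)) in Dc.
    change (is_derive Kt t (ad t * (a t / ad t * (1 - accel_ratio t) / c t))) in DK.
    assert (Ec : c t ^ 2 = A ^ 2 - a t ^ 2).
    { unfold c. rewrite pow2_sqrt; auto.
      pose proof (a_lt t tau ltac:(lra) ltac:(lra)). pose proof (a_pos t ltac:(lra)).
      fold A in H1. nra. }
    auto_derive; [repeat split; try (eexists; eassumption); lra|].
    replace (Derive (fun x => ad x) t) with (ad2 t) by (symmetry; now apply is_derive_unique).
    replace (Derive (fun x => c x) t) with (- (a t * ad t) / c t)
      by (symmetry; now apply is_derive_unique).
    replace (Derive (fun x => Kt x) t) with (ad t * (a t / ad t * (1 - accel_ratio t) / c t))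
      by (symmetry; now apply is_derive_unique).
    (* [field] does not know that [c t] is a square root. The two sides differ by an explicit
       multiple of [c t ^ 2 - (A ^ 2 - a t ^ 2)], which is then rewritten to zero. *)
    apply Rminus_diag_uniq.
    transitivity (ad2 t * c0 / (ad t ^ 2 * c t * A ^ 2) * (c t ^ 2 - (A ^ 2 - a t ^ 2))).
    - unfold accel_ratio. field. lra.
    - rewrite Ec. ring. }
  rewrite (iint_primitive _ (fun t => / ad t * (1 - c0 * c t / A ^ 2) - c0 / A ^ 2 * Kt t)
    t0 tau ((a t0 * hubble_radius (a t0) - c0 * abel hubble_slope A (a t0)) / A ^ 2) (/ ad tau - c0 / A ^ 2 * abel_full hubble_slope A)).
  - unfold Psi. fold A. fold c0. rewrite abel_Rabs by lra. fold c0. field. lra.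
  - lra.
  - intros t H. split; [apply DG; lra|].
    assert (Hr : Rabs t < tau) by (rewrite Rabs_right; lra).
    pose proof (gap_pos tau t Hr). pose proof (ad_pos t ltac:(lra)).
    unfold Rdiv. apply continuity_pt_mult.
    + apply continuity_pt_mult.
      * eapply continuity_pt_of_is_derive, ad2_deriv. lra.
      * apply continuity_pt_inv; [|apply pow_nonzero; lra].
        apply (continuity_pt_comp ad (fun x => x ^ 2)); [|apply derivable_continuous_pt, derivable_pt_pow].
        eapply continuity_pt_of_is_derive, ad_deriv. lra.
    + apply continuity_pt_minus; [|apply continuity_pt_const; intros ? ?; reflexivity].
      apply continuity_pt_mult; [apply continuity_pt_const; intros ? ?; reflexivity|].
      apply continuity_pt_inv; [apply gap_continuity | exact (Rgt_not_eq _ _ (gap_pos tau t Hr))].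
  - destruct (Req_dec t0 0) as [Hz|Hz].
    + assert (Ec0 : c0 = A).
      { unfold c0. rewrite Hz, a_0. replace (A ^ 2 - 0 ^ 2) with (A ^ 2) by ring.
        apply sqrt_pow2. lra. }
      (* At [t0 = 0] the factor [/ ad t] may blow up. Since [c0 = A], rationalizing [1 - c t / A]
         into [a t ^ 2 / (A * (A + c t))] absorbs it into the Hubble radius; [M] is the resulting
         continuous form of the primitive. *)
      set (M := fun t => hubble_radius (signed_a t) * a t * / (A * (A + c t)) - c0 / A ^ 2 * Kt t).
      assert (Ez : (a t0 * hubble_radius (a t0) - c0 * abel hubble_slope A (a t0)) / A ^ 2 = M 0).
      { unfold M, Kt. rewrite Hz, (signed_a_nonneg 0), a_0, abel_0 by lra. unfold Rdiv. ring. }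
      rewrite Ez, Hz. apply (filterlim_ext_loc M).
      * exists (mkposreal tau Ht). intros t Hb Hlt. change (Rabs (t - 0) < tau) in Hb.
        rewrite Rminus_0_r in Hb. assert (Hc := gap_pos tau t Hb). change (0 < c t) in Hc.
        pose proof (a_lt_of_Rabs t tau Hb) as HtA. fold A in HtA. pose proof (a_pos t Hlt) as Hat.
        assert (Hgp : 0 <= A ^ 2 - a t ^ 2) by nra.
        assert (Ec : c t ^ 2 = A ^ 2 - a t ^ 2) by (unfold c; rewrite pow2_sqrt; auto).
        pose proof (ad_pos t Hlt).
        unfold M. rewrite hubble_radius_sg by auto. rewrite Ec0. f_equal.
        apply Rminus_diag_uniq.
        transitivity ((a t ^ 2 - (A ^ 2 - c t ^ 2)) / (ad t * A * (A + c t))); [field; lra|].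
        rewrite Ec. field. lra.
      * apply filterlim_at_right_of_continuity. unfold M.
        assert (Hr : Rabs 0 < tau) by (rewrite Rabs_R0; lra).
        assert (Hc := gap_pos tau 0 Hr). change (0 < c 0) in Hc.
        apply continuity_pt_minus.
        -- apply continuity_pt_mult; [apply continuity_pt_mult|].
           ++ apply (continuity_pt_comp signed_a hubble_radius); [apply signed_a_continuity | apply hubble_radius_cont].
           ++ apply a_continuity.
           ++ apply continuity_pt_inv; [|nra].
              apply continuity_pt_mult; [apply continuity_pt_const; intros ? ?; reflexivity|].
              apply continuity_pt_plus; [apply continuity_pt_const; intros ? ?; reflexivity|].
              apply gap_continuity.
        -- apply continuity_pt_mult; [apply continuity_pt_const; intros ? ?; reflexivity|].
           now apply CK.
    + assert (H : 0 < t0 < tau) by lra. pose proof (ad_pos t0 ltac:(lra)).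
      replace ((a t0 * hubble_radius (a t0) - c0 * abel hubble_slope A (a t0)) / A ^ 2)
        with (/ ad t0 * (1 - c0 * c t0 / A ^ 2) - c0 / A ^ 2 * Kt t0).
      * apply (filterlim_at_right_of_continuity
          (fun t => / ad t * (1 - c0 * c t / A ^ 2) - c0 / A ^ 2 * Kt t)).
        eapply continuity_pt_of_is_derive. now apply DG.
      * unfold Kt. change (c t0) with c0. rewrite <- (signed_a_nonneg t0) at 2 3 by lra.
        rewrite hubble_radius_sg by lra. apply Rminus_diag_uniq.
        transitivity ((A ^ 2 - a t0 ^ 2 - c0 ^ 2) / (ad t0 * A ^ 2)); [rewrite (signed_a_nonneg t0) by lra; field; lra|].
        rewrite Hc0. field. lra.
  - apply (filterlim_minus_scal _ _ (fun t => / ad t * (1 - c0 * c t / A ^ 2)) Kt (/ ad tau) (abel_full hubble_slope A)).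
    + replace (/ ad tau) with (/ ad tau * (1 - c0 * c tau / A ^ 2)).
      * apply (filterlim_at_left_of_continuity (fun t => / ad t * (1 - c0 * c t / A ^ 2))).
        apply continuity_pt_mult.
        -- apply continuity_pt_inv; [|lra]. eapply continuity_pt_of_is_derive. now apply ad_deriv.
        -- apply continuity_pt_minus; [apply continuity_pt_const; intros ? ?; reflexivity|].
           apply continuity_pt_mult; [|apply continuity_pt_const; intros ? ?; reflexivity].
           apply continuity_pt_mult; [apply continuity_pt_const; intros ? ?; reflexivity|].
           apply gap_continuity.
      * unfold c. fold A. rewrite Rminus_diag, sqrt_0. field. lra.
    + apply filterlim_abel_a; auto. exact hubble_slope_cont.
Qed.

(* [sqrt] is [0] on negative numbers, so the integrand is continuous on all of [v > 0],
   including [v > A]. *)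
Definition chi_reg (A x : R) : R := RInt (fun v => hubble_slope v * sqrt (A ^ 2 - v ^ 2) / v ^ 2) 1 x.

Lemma continuity_2d_pt_chi_reg_integrand (A v : R) : 0 < v ->
  continuity_2d_pt (fun A v => hubble_slope v * sqrt (A ^ 2 - v ^ 2) / v ^ 2) A v.
Proof.
  intros Hv. pose proof (continuity_2d_pt_snd hubble_slope A v (hubble_slope_cont v)).
  unfold Rdiv. cont2. all: try apply pow_nonzero; lra.
Qed.

Lemma continuity_2d_pt_chi_reg (A x : R) : 0 < x -> continuity_2d_pt chi_reg A x.
Proof.
  intros Hx. apply (continuity_2d_pt_RInt _ 1 A x 0 (x + 2)); try lra.
  apply filter_forall. intros A' v Hv. apply continuity_2d_pt_chi_reg_integrand. lra.
Qed.

Lemma is_derive_chi_reg (A x : R) : 0 < x ->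
  is_derive (chi_reg A) x (hubble_slope x * sqrt (A ^ 2 - x ^ 2) / x ^ 2).
Proof.
  intros Hx. apply (is_derive_RInt_upper (fun v => hubble_slope v * sqrt (A ^ 2 - v ^ 2) / v ^ 2) 1 x 0 (x + 2));
    try lra.
  intros t Ht. apply (continuity_2d_pt_slice2 (fun A v => hubble_slope v * sqrt (A ^ 2 - v ^ 2) / v ^ 2)).
  apply continuity_2d_pt_chi_reg_integrand. lra.
Qed.

(** The primitive [T] comes from integration by parts. Unlike the integrand it is continuous at
    [tau], where its square root term vanishes. Only differences of [chi_reg] occur, so its base
    point [1] is an arbitrary positive number. *)
Lemma chi_integral (tau s : R) : 0 < s < tau ->
  chi a s tau = sqrt (a tau ^ 2 - a s ^ 2) / (ad s * a tau) +
    (chi_reg (a tau) (a tau) - chi_reg (a tau) (a s)) / a tau.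
Proof.
  intros Hs. assert (Ht : 0 < tau) by lra. unfold chi.
  set (A := a tau). set (c := fun t => sqrt (A ^ 2 - a t ^ 2)).
  assert (HA : 0 < A) by now apply a_pos.
  set (Jt := fun t => chi_reg A (a t)).
  set (T := fun t => Jt t / A - c t / (ad t * A)).
  assert (DJ : forall t, 0 < t -> is_derive Jt t (ad t * (hubble_slope (a t) * c t / a t ^ 2))).
  { intros t H. apply (is_derive_comp (chi_reg A) a); [|now apply a_deriv].
    apply (is_derive_chi_reg A (a t)). now apply a_pos. }
  assert (CT : forall t, 0 < t -> continuity_pt T t).
  { intros t H. pose proof (ad_pos t H). unfold T, Rdiv. apply continuity_pt_minus; apply continuity_pt_mult.
    - eapply continuity_pt_of_is_derive. now apply DJ.
    - apply continuity_pt_const; intros ? ?; reflexivity.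
    - apply gap_continuity.
    - apply continuity_pt_inv; [|nra].
      apply continuity_pt_mult; [|apply continuity_pt_const; intros ? ?; reflexivity].
      eapply continuity_pt_of_is_derive. now apply ad_deriv. }
  rewrite (iint_primitive _ T s tau (T s) (T tau)).
  - unfold T, Jt, c. fold A. rewrite Rminus_diag, sqrt_0.
    pose proof (ad_pos s ltac:(lra)). pose proof (ad_pos tau Ht). field. lra.
  - lra.
  - intros t H. assert (H' : 0 < t < tau) by lra.
    assert (Hr : Rabs t < tau) by (rewrite Rabs_right; lra).
    pose proof (gap_pos tau t Hr) as Hc. pose proof (ad_pos t ltac:(lra)) as Hd.
    pose proof (a_pos t ltac:(lra)) as Hat. split.
    + pose proof (ad_deriv t ltac:(lra)) as D2. pose proof (is_derive_gap tau t H') as Dc.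
      pose proof (DJ t ltac:(lra)) as DJt. rewrite <- (signed_a_nonneg t) in DJt at 1 by lra.
      rewrite hubble_slope_sg in DJt by lra.
      fold A in Hc, Dc. change (0 < c t) in Hc.
      change (is_derive c t (- (a t * ad t) / c t)) in Dc.
      assert (Ec : c t ^ 2 = A ^ 2 - a t ^ 2).
      { unfold c. rewrite pow2_sqrt; auto.
        pose proof (a_lt t tau ltac:(lra) ltac:(lra)) as Hlt. fold A in Hlt. nra. }
      unfold T. fold A. change (sqrt (A ^ 2 - a t ^ 2)) with (c t).
      auto_derive; [repeat split; try (eexists; eassumption); nra|].
      replace (Derive (fun x => ad x) t) with (ad2 t) by (symmetry; now apply is_derive_unique).
      replace (Derive (fun x => c x) t) with (- (a t * ad t) / c t)
        by (symmetry; now apply is_derive_unique).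
      replace (Derive (fun x => Jt x) t) with (ad t * (a t / ad t * (1 - accel_ratio t) * c t / a t ^ 2))
        by (symmetry; now apply is_derive_unique).
      apply Rminus_diag_uniq.
      transitivity ((c t ^ 2 - (A ^ 2 - a t ^ 2)) / (a t * c t * A)).
      * unfold accel_ratio. field. lra.
      * rewrite Ec. field. lra.
    + fold A. fold A in Hc. apply continuity_pt_mult.
      * apply continuity_pt_inv; [apply a_continuity | lra].
      * unfold Rdiv. apply continuity_pt_mult; [apply continuity_pt_const; intros ? ?; reflexivity|].
        apply continuity_pt_inv; [apply gap_continuity | lra].
  - apply (filterlim_at_right_of_continuity T), CT. lra.
  - apply (filterlim_at_left_of_continuity T), CT. lra.
Qed.

(* [areal_radius (a tau) (signed_a t0) = a t0 * chi]; the formula gives [0] at [t0 = 0]. *)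
Definition areal_radius (A u : R) : R :=
  (hubble_radius u * sqrt (A ^ 2 - u ^ 2) + Rabs u * (chi_reg A A - chi_reg A (Rabs u))) / A.

Lemma areal_radius_chi (tau t0 : R) : t0 <> 0 -> Rabs t0 < tau ->
  areal_radius (a tau) (signed_a t0) = a t0 * chi a (Rabs t0) tau.
Proof.
  intros Hn H. assert (Hp : 0 < Rabs t0) by now apply Rabs_pos_lt.
  rewrite chi_integral by lra. unfold areal_radius. rewrite Rabs_signed_a, signed_a_sq, a_Rabs.
  pose proof (ad_pos _ Hp). pose proof (a_pos tau ltac:(lra)).
  replace (hubble_radius (signed_a t0)) with (a t0 / ad (Rabs t0)).
  - field. lra.
  - rewrite <- a_Rabs, <- (hubble_radius_sg _ Hp). unfold hubble_radius, signed_a.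
    destruct (Rle_dec 0 (Rabs t0)); [|lra]. rewrite a_Rabs.
    destruct (Rle_dec 0 t0); [reflexivity|]. now rewrite pull_even.
Qed.

(** The delicate point is [u = 0], where [chi_reg A |u|] need not stay bounded. The integral is
    split at a small [x1] below which [hubble_slope <= e]: the part beyond [x1] is bounded by [M]
    and is killed by the factor [|u|], while the part below is at most [e * A' / |u|]. *)
Lemma continuity_2d_pt_areal_radius (A u : R) : Rabs u < A -> continuity_2d_pt areal_radius A u.
Proof.
  intros H. assert (HA : 0 < A) by (pose proof (Rabs_pos u); lra).
  assert (CJA : continuity_2d_pt (fun A _ => chi_reg A A) A u).
  { apply (continuity_2d_pt_comp2 chi_reg (fun A _ => A) (fun A _ => A)); cont2.
    now apply continuity_2d_pt_chi_reg. }
  pose proof (continuity_2d_pt_snd hubble_radius A u (hubble_radius_cont u)).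
  cut (continuity_2d_pt (fun A u => Rabs u * (chi_reg A A - chi_reg A (Rabs u))) A u).
  { intros C. unfold areal_radius, Rdiv. cont2. lra. }
  destruct (Req_dec u 0) as [->|Hu].
  2:{ cont2. apply (continuity_2d_pt_comp2 chi_reg (fun A _ => A) (fun _ u => Rabs u)); cont2.
      apply continuity_2d_pt_chi_reg. now apply Rabs_pos_lt. }
  intros eps. rewrite Rabs_R0, Rmult_0_l.
  (* The constraint [|A' - A| < A] gives [A' < 2 * A], hence [e * A' <= eps / 2]. *)
  set (e := eps / (4 * A)).
  assert (He : 0 < e) by (apply Rdiv_lt_0_compat; [apply cond_pos | lra]).
  destruct (hubble_slope_cont 0 e He) as [d1 [Hd1 Hw]]. simpl in Hw. unfold Rdist in Hw.
  set (x1 := d1 / 2).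
  assert (Hx1 : 0 < x1 < d1) by (unfold x1; lra).
  assert (Hw' : forall v, 0 < v <= x1 -> hubble_slope v <= e).
  { intros v Hv. specialize (Hw v). unfold hubble_slope at 2 in Hw. rewrite pull_0, !Rminus_0_r in Hw.
    assert (Q : Rabs (hubble_slope v) < e).
    { apply Hw. split; [split; [exact I | lra]|]. rewrite Rabs_right; lra. }
    apply Rabs_def2 in Q. lra. }
  assert (CJ1 : continuity_2d_pt (fun A _ => chi_reg A A - chi_reg A x1) A 0).
  { cont2. apply (continuity_2d_pt_comp2 chi_reg (fun A _ => A) (fun _ _ => x1)); cont2.
    apply continuity_2d_pt_chi_reg. lra. }
  destruct (CJ1 (mkposreal 1 Rlt_0_1)) as [d2 H2]. simpl in H2.
  set (M := Rabs (chi_reg A A - chi_reg A x1) + 1).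
  assert (HM : 0 < M) by (unfold M; pose proof (Rabs_pos (chi_reg A A - chi_reg A x1)); lra).
  set (d := Rmin (Rmin A x1) (Rmin d2 (eps / 2 / M))).
  assert (Hd : 0 < d).
  { repeat apply Rmin_glb_lt; try lra; [apply cond_pos|].
    repeat apply Rdiv_lt_0_compat; try lra; apply cond_pos. }
  assert (Hb : d <= A /\ d <= x1 /\ d <= d2 /\ d <= eps / 2 / M)
    by (unfold d, Rmin; repeat destruct Rle_dec; lra).
  exists (mkposreal d Hd). simpl. intros A' u HA' Hu.
  rewrite Rminus_0_r in *.
  assert (H2' := H2 A' 0 ltac:(lra) ltac:(rewrite Rminus_diag, Rabs_R0; apply cond_pos)).
  apply Rabs_def2 in HA'.
  set (x := Rabs u) in *. assert (Hx0 : 0 <= x) by apply Rabs_pos.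
  pose proof (cond_pos eps) as Heps.
  destruct Hx0 as [Hx0|<-]; [|rewrite Rmult_0_l, Rabs_R0; exact Heps].
  assert (Hup : chi_reg A' x1 - chi_reg A' x <= e * A' / x).
  (* Comparison with [e * A' / v], whose derivative [- e * A' / v^2] outweighs the integrand, as
     [hubble_slope v <= e] and the square root is at most [A']. *)
  { assert (Q : chi_reg A' x1 + e * A' / x1 <= chi_reg A' x + e * A' / x).
    { apply (antitone_of_derive (fun v => chi_reg A' v + e * A' / v)
        (fun v => hubble_slope v * sqrt (A' ^ 2 - v ^ 2) / v ^ 2 + - (e * A') / v ^ 2)); [lra|].
      intros v Hv. split.
      - apply (is_derive_plus (V := R_NormedModule) (chi_reg A') (fun v => e * A' / v)).
        + apply is_derive_chi_reg. lra.
        + auto_derive; [lra|]. field. lra.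
      - assert (sqrt (A' ^ 2 - v ^ 2) <= A').
        { rewrite <- (sqrt_pow2 A') at 2 by lra. apply sqrt_le_1_alt. nra. }
        pose proof (sqrt_pos (A' ^ 2 - v ^ 2)). pose proof (hubble_slope_nonneg v).
        specialize (Hw' v ltac:(lra)).
        replace (hubble_slope v * sqrt (A' ^ 2 - v ^ 2) / v ^ 2 + - (e * A') / v ^ 2)
          with (- ((e * A' - hubble_slope v * sqrt (A' ^ 2 - v ^ 2)) * / v ^ 2)) by (field; lra).
        assert (0 <= (e * A' - hubble_slope v * sqrt (A' ^ 2 - v ^ 2)) * / v ^ 2); [|lra].
        apply Rmult_le_pos; [nra|]. left. apply Rinv_0_lt_compat. nra. }
    assert (0 < e * A' / x1) by (repeat apply Rdiv_lt_0_compat; try lra; apply Rmult_lt_0_compat; lra).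
    lra. }
  assert (Hlo : 0 <= chi_reg A' x1 - chi_reg A' x).
  { assert (Q : - chi_reg A' x1 <= - chi_reg A' x); [|lra].
    apply (antitone_of_derive (fun v => - chi_reg A' v)
      (fun v => - (hubble_slope v * sqrt (A' ^ 2 - v ^ 2) / v ^ 2))); [lra|].
    intros v Hv. split; [apply (is_derive_opp (V := R_NormedModule) (chi_reg A')), is_derive_chi_reg; lra|].
    pose proof (sqrt_pos (A' ^ 2 - v ^ 2)). pose proof (hubble_slope_nonneg v).
    assert (0 <= hubble_slope v * sqrt (A' ^ 2 - v ^ 2) / v ^ 2); [|lra].
    apply Rmult_le_pos; [nra|]. left. apply Rinv_0_lt_compat. nra. }
  assert (Hm : Rabs (chi_reg A' A' - chi_reg A' x1) <= M).
  { unfold M. replace (chi_reg A' A' - chi_reg A' x1) with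
      ((chi_reg A A - chi_reg A x1) + (chi_reg A' A' - chi_reg A' x1 - (chi_reg A A - chi_reg A x1))) by ring.
    eapply Rle_trans; [apply Rabs_triang|]. lra. }
  assert (X1 : x * (chi_reg A' x1 - chi_reg A' x) <= eps / 2).
  { apply Rle_trans with (x * (e * A' / x)); [apply Rmult_le_compat_l; lra|].
    replace (x * (e * A' / x)) with (e * A') by (field; lra).
    replace (eps / 2) with (e * (2 * A)) by (unfold e; field; lra).
    apply Rmult_le_compat_l; lra. }
  assert (X2 : x * M < eps / 2).
  { replace (eps / 2) with (eps / 2 / M * M) by (field; lra). apply Rmult_lt_compat_r; lra. }
  replace (x * (chi_reg A' A' - chi_reg A' x)) with (x * (chi_reg A' A' - chi_reg A' x1) + x * (chi_reg A' x1 - chi_reg A' x)) by ring.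
  eapply Rle_lt_trans; [apply Rabs_triang|]. rewrite Rabs_mult, (Rabs_right x) by lra.
  rewrite (Rabs_right (x * _)) by (apply Rle_ge, Rmult_le_pos; lra).
  assert (x * Rabs (chi_reg A' A' - chi_reg A' x1) <= x * M) by (apply Rmult_le_compat_l; lra). lra.
Qed.

(** The range [0 < r < 2 * abel_full] is the condition for [abel_full - r] to be a value of the
    incomplete integral. The corresponding [u] is brought back to a time by [a_inv], with the sign
    of [u]. *)
Lemma t0fun_spec (tau r : R) : chart_range hubble_radius a tau r ->
  - tau < t0fun a tau r < tau /\ r = rho_of a tau (t0fun a tau r).
Proof.
  intros [Ht Hr]. unfold t0fun.
  apply (epsilon_spec (inhabits 0) (fun t0 => - tau < t0 < tau /\ r = rho_of a tau t0)).
  destruct (abel_surj hubble_radius hubble_radius_cont (a tau) (abel_full hubble_radius (a tau) - r)) as [u [Hu E]].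
  - intros v. apply pull_even.
  - now apply a_pos.
  - apply Rabs_def1; lra.
  - assert (Hb : a_inv (Rabs u) < tau).
    { destruct (a_inv_spec (Rabs u) (Rabs_pos u)). apply a_lt_inv; lra. }
    destruct (a_inv_spec (Rabs u) (Rabs_pos u)) as [Hb0 Eb].
    assert (Hex : exists t0, - tau < t0 < tau /\ signed_a t0 = u).
    { destruct (Rle_dec 0 u) as [Hu0|Hu0].
      - exists (a_inv (Rabs u)). split; [lra|]. rewrite signed_a_nonneg, Eb, Rabs_right; lra.
      - assert (0 < a_inv (Rabs u)) by (apply a_inv_pos, Rabs_pos_lt; lra).
        exists (- a_inv (Rabs u)). split; [lra|].
        rewrite signed_a_neg, a_even, Eb, Rabs_left; lra. }
    destruct Hex as [t0 [H0 Es]]. exists t0. split; auto.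
    rewrite rho_integral by auto. rewrite Es. lra.
Qed.

Definition chart_coord (tau r : R) : R := signed_a (t0fun a tau r).

Lemma chart_coord_spec (tau r : R) : chart_range hubble_radius a tau r ->
  Rabs (chart_coord tau r) < a tau /\ rho_chart hubble_radius a tau (chart_coord tau r) = r.
Proof.
  intros H. destruct (t0fun_spec tau r H) as [H0 E]. destruct H as [Ht _]. unfold chart_coord. split.
  - rewrite Rabs_signed_a. apply a_lt_of_Rabs, Rabs_def1; lra.
  - unfold rho_chart. rewrite <- rho_integral by auto. auto.
Qed.

Lemma gtautau_eq (tau r : R) : ad = adot a -> ad2 = addot a -> chart_range hubble_radius a tau r ->
  gtautau a tau r = gtt_chart hubble_radius hubble_slope a ad tau (chart_coord tau r).
Proof.
  intros E1 E2 H. destruct (t0fun_spec tau r H) as [H0 _]. destruct H as [Ht _].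
  pose proof (ad_pos tau Ht) as Hd. pose proof (a_pos tau Ht) as Ha.
  unfold gtautau, gtt_chart, chart_coord. rewrite <- E1. set (t0 := t0fun a tau r) in *.
  f_equal. f_equal.
  assert (Ef : forall t, 0 <= t < tau ->
    f_pos a tau t = (1 - ad tau * Psi hubble_radius hubble_slope (a tau) (a t) / a tau ^ 2) / ad tau).
  { intros t H. rewrite <- f_integral by auto. unfold f_pos. now rewrite E1, E2. }
  unfold ffun, signed_a. destruct (Rle_dec 0 t0).
  - rewrite Ef by lra. field. lra.
  (* Negative [t0]: as [Psi A 0 = A * abel_full w A], the reflection rule
     [2 f(tau, 0) - f(tau, - t0)] becomes exactly [Psi_opp]. *)
  - rewrite !Ef by lra. rewrite a_even, a_0.
    rewrite Psi_opp.
    + replace (Psi hubble_radius hubble_slope (a tau) 0) with (a tau * abel_full hubble_slope (a tau)).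
      * field. lra.
      * unfold Psi. rewrite !abel_0. ring.
    + exact hubble_slope_cont.
    + intros v. apply pull_even.
    + intros v. apply pull_even.
    + rewrite Rabs_right; [apply a_lt_of_Rabs, Rabs_def1; lra | apply Rle_ge, a_nonneg].
Qed.

Lemma rhoM_eq (tau : R) : 0 < tau -> rhoM a tau = abel_full hubble_radius (a tau).
Proof.
  intros Ht. unfold rhoM. rewrite rho_integral by lra. rewrite signed_a_nonneg, a_0, abel_0; lra.
Qed.

(** Each zero lies below [2 * rhoM], so [rho_max] is at most [2 * rhoM]. The regularity results are
    proved on this larger domain, which is known to be open. *)
Lemma chart_range_of_Dtr (tau r : R) : Dtr a tau r -> chart_range hubble_radius a tau r.
Proof.
  intros [Ht [Hr0 Hr]]. split; auto. split; auto. rewrite <- rhoM_eq by auto.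
  apply Rlt_le_trans with (1 := Hr). unfold rho_max.
  destruct excluded_middle_informative as [[r1 H1]|_]; [|lra].
  destruct (Glb_Rbar_correct (gtt_zeros a tau)) as [Hlb Hglb].
  (* Lying between [0] and the zero [r1], the infimum is finite, so [real] returns it and not its
     default value. *)
  assert (B0 : Rbar_le 0 (Glb_Rbar (gtt_zeros a tau))).
  { apply Hglb. intros x [Hx _]. simpl. lra. }
  assert (B1 : Rbar_le (Glb_Rbar (gtt_zeros a tau)) r1) by now apply Hlb.
  destruct H1 as [H1 _].
  destruct (Glb_Rbar (gtt_zeros a tau)); simpl in *; lra.
Qed.

End ScaleFactor.

(** * Behaviour of the scale factor at time zero, and conclusion *)

Lemma at_right_0_estimate (f : R -> R) (y e : R) :
  filterlim f (at_right 0) (locally y) -> 0 < e ->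
  exists d, 0 < d /\ forall t, 0 < t < d -> Rabs (f t - y) < e.
Proof.
  intros H He.
  assert (Hl : locally y (fun z => Rabs (z - y) < e)) by (exists (mkposreal e He); intros z Hz; exact Hz).
  destruct (H _ Hl) as [d Hd]. exists d. split; [apply cond_pos|].
  intros t Ht. apply Hd; [|lra]. change (Rabs (t - 0) < d).
  rewrite Rminus_0_r, Rabs_right; lra.
Qed.

Lemma derive_nonneg_of_increasing (f : R -> R) (x l : R) :
  (forall t, x < t -> f x < f t) -> is_derive f x l -> 0 <= l.
Proof.
  intros Hf H. apply Rnot_lt_le. intros Hl.
  destruct (is_derive_estimate f x l (- l / 2) H) as [d [Hd He]]; [lra|].
  specialize (He (x + d / 2)). replace (x + d / 2 - x) with (d / 2) in He by ring.
  rewrite (Rabs_right (d / 2)) in He by lra. specialize (He ltac:(lra)).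
  apply Rabs_le_between in He. specialize (Hf (x + d / 2) ltac:(lra)). nra.
Qed.

Lemma cont_within2_of_continuity (f : R -> R -> R) (D : R -> R -> Prop) (x y : R) :
  continuity_2d_pt f x y -> cont_within2 f D x y.
Proof.
  intros H e He. destruct (H (mkposreal e He)) as [d Hd]. exists d.
  split; [apply cond_pos|]. intros x' y' _ Hx Hy. now apply Hd.
Qed.

(* In case (i) [adot] is nondecreasing near [0], so [a t <= t adot t] by the mean value theorem. *)
Lemma ratio_small (a ad : R -> R) (L e : R) :
  a 0 = 0 -> (forall t, 0 <= t -> continuity_pt a t) ->
  (forall t, 0 < t -> 0 < ad t) -> (forall t, 0 < t -> is_derive a t (ad t)) ->
  (forall e, 0 < e -> exists d, 0 < d /\ forall t, 0 < t < d -> Rabs (ad t - L) < e) ->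
  ((exists r, 0 < r /\ forall s t, 0 < s -> s <= t -> t < r -> ad s <= ad t) \/ 0 < L) ->
  0 < e -> exists d, 0 < d /\ forall t, 0 < t < d -> a t / ad t < e.
Proof.
  intros H0 Hc Hp Hd' HL Hcase He.
  assert (Small : forall e, 0 < e -> exists d, 0 < d /\ forall t, 0 < t < d -> a t < e).
  { intros e' He'. destruct (Hc 0 ltac:(lra) e' He') as [d [Hd H]]. exists d. split; auto.
    simpl in H. unfold Rdist in H. intros t Ht. specialize (H t). rewrite H0, !Rminus_0_r in H.
    eapply Rle_lt_trans; [apply Rle_abs|]. apply H. split; [split; [exact I | lra]|].
    rewrite Rabs_right; lra. }
  destruct Hcase as [[r [Hr Hm]]|Hpos].
  - exists (Rmin r e). split; [now apply Rmin_glb_lt|]. intros t Ht.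
    pose proof (Rmin_l r e). pose proof (Rmin_r r e).
    assert (Hat : a t <= ad t * t).
    { apply le_epsilon. intros e' He'. destruct (Small e' He') as [d [Hd Ha]].
      set (s := Rmin d t / 2). pose proof (Rmin_l d t). pose proof (Rmin_r d t).
      assert (0 < Rmin d t) by (apply Rmin_glb_lt; lra).
      assert (Hs : 0 < s < t /\ s < d) by (unfold s; lra).
      pose proof (Ha s ltac:(lra)). pose proof (Hp t ltac:(lra)).
      assert (a t - ad t * t <= a s - ad t * s); [|nra].
      apply (antitone_of_derive (fun x => a x - ad t * x) (fun x => ad x - ad t)); [lra|].
      intros x Hx. split; [|pose proof (Hm x t); lra].
      apply (is_derive_minus (V := R_NormedModule) a (fun x => ad t * x)); [apply Hd'; lra|].
      auto_derive; auto; ring. }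
    pose proof (Hp t ltac:(lra)). apply Rle_lt_trans with t; [|lra].
    apply Rmult_le_reg_r with (ad t); auto.
    replace (a t / ad t * ad t) with (a t) by (field; lra). lra.
  - destruct (HL (L / 2)) as [d1 [Hd1 H1]]; [lra|].
    destruct (Small (e * (L / 2))) as [d2 [Hd2 H2]]; [nra|].
    exists (Rmin d1 d2). split; [now apply Rmin_glb_lt|]. intros t Ht.
    pose proof (Rmin_l d1 d2). pose proof (Rmin_r d1 d2).
    specialize (H1 t ltac:(lra)). specialize (H2 t ltac:(lra)). apply Rabs_def2 in H1.
    apply Rmult_lt_reg_r with (ad t); [lra|].
    replace (a t / ad t * ad t) with (a t) by (field; lra). nra.
Qed.

Theorem theorem7p5 (a : R -> R) (theta0 : R) :
  strongly_regular_scale_factor a ->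
  (forall t, a (- t) = a t) ->
  ((filterlim (adot a) (at_right 0) (locally 0) /\
      exists eps, 0 < eps /\ forall t, 0 < t < eps -> 0 <= addot a t)
   \/ (exists L, 0 < L /\ filterlim (adot a) (at_right 0) (locally L))) ->
  (forall t, 0 < t -> ex_derive (addot a) t) ->
  (exists C, 0 < C /\
     forall t, 0 < t -> Rabs (adddot a t * a t ^ 2 / adot a t ^ 3) <= C) ->
  C1_on2 (gtautau a) (Dtr a) /\
  exists G : R -> R -> R,
    (forall tau rho, Dtr a tau rho -> t0fun a tau rho <> 0 ->
       G tau rho = gthth 0 a tau rho) /\
    (forall tau rho, Dtr a tau rho -> cont_within2 G (Dtr a) tau rho) /\
    (forall tau rho theta, Dtr a tau rho -> theta0 < theta < theta0 + PI ->
       cont_within3 (fun tau' rho' theta' => G tau' rho' * sin theta' ^ 2)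
         (fun tau' rho' theta' => Dtr a tau' rho' /\ theta0 < theta' < theta0 + PI)
         tau rho theta).
Proof.
  intros [(H0 & Hlt & Hsurj & Hc0 & Hc & HC2 & Hne & Hq1) [K1 [HK1 Hq2]]] Hev Hcase Hd3 [C1 [HC1 H3]].
  (* At [0] only the one-sided limit is given; evenness makes it two-sided. *)
  assert (Hcont : forall t, 0 <= t -> continuity_pt a t).
  { intros t [Ht|<-]; [apply continuity_pt_filterlim, Hc; auto|].
    intros e He. destruct (at_right_0_estimate a (a 0) e Hc0 He) as [d [Hd H]].
    exists d. split; auto. intros x [[_ Hx] Hxd]. simpl in *. unfold Rdist in *.
    rewrite Rminus_0_r in Hxd. assert (0 < Rabs x) by (apply Rabs_pos_lt; auto).
    replace (a x) with (a (Rabs x)) by (unfold Rabs; destruct (Rcase_abs x); auto).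
    apply H. lra. }
  assert (D1 : forall t, 0 < t -> is_derive a t (adot a t))
    by (intros t Ht; apply Derive_correct, HC2, Ht).
  assert (D2 : forall t, 0 < t -> is_derive (adot a) t (addot a t))
    by (intros t Ht; apply (Derive_correct (Derive a)), HC2, Ht).
  assert (D3 : forall t, 0 < t -> is_derive (addot a) t (adddot a t))
    by (intros t Ht; apply (Derive_correct (addot a)), Hd3, Ht).
  assert (Hpos : forall t, 0 < t -> 0 < adot a t).
  { intros t Ht. destruct (derive_nonneg_of_increasing a t (adot a t)) as [H|H]; auto.
    - intros s Hs. apply Hlt; lra.
    - exfalso. now apply (Hne t Ht). }
  (* Both cases are reduced to one form: a finite limit [L] of [adot], together with either
     monotonicity of [adot] near [0] (from [addot >= 0]) or [L > 0], the alternative under which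
     [ratio_small] gives [a / adot -> 0]. *)
  assert (HL : exists L, (forall e, 0 < e -> exists d, 0 < d /\
      forall t, 0 < t < d -> Rabs (adot a t - L) < e) /\
    ((exists r, 0 < r /\ forall s t, 0 < s -> s <= t -> t < r -> adot a s <= adot a t) \/ 0 < L)).
  { destruct Hcase as [[Hl [r [Hr Hdd]]]|[L [HL Hl]]].
    - exists 0. split; [intros e He; now apply at_right_0_estimate|].
      left. exists r. split; auto. intros s t Hs Hst Htr.
      apply Ropp_le_cancel.
      apply (antitone_of_derive (fun t => - adot a t) (fun t => - addot a t)); auto.
      intros x Hx. split.
      + apply (is_derive_opp (V := R_NormedModule) (adot a)), D2. lra.
      + specialize (Hdd x ltac:(lra)). lra.
    - exists L. split; [intros e He; now apply at_right_0_estimate | now right]. }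
  destruct HL as [L [HL Hratio]].
  assert (Hpt : forall e, 0 < e -> exists d, 0 < d /\ forall t, 0 < t < d -> a t / adot a t < e)
    by (intros e He; now apply (ratio_small a (adot a) L e)).
  assert (Hq : forall t, 0 < t -> - K1 <= a t * addot a t / adot a t ^ 2 <= 1) by auto.
  set (p := hubble_radius a (adot a)). set (w := hubble_slope a (adot a) (addot a)). set (l := expansion_rate a (adot a) L).
  assert (Cp : forall u, continuity_pt p u) by (eapply hubble_radius_cont; eassumption).
  assert (Cw : forall u, continuity_pt w u) by (eapply hubble_slope_cont; eassumption).
  assert (Cl : forall u, continuity_pt l u) by (eapply expansion_rate_cont; eassumption).
  destruct (abel_full_C1 p Cp) as [dVp HVp]; [eapply hubble_radius_lipschitz; eassumption|].
  destruct (abel_full_C1 w Cw) as [dVw HVw]; [eapply hubble_slope_lipschitz; eassumption|].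
  set (U := chart_coord a).
  assert (HU : forall t r, chart_range p a t r -> Rabs (U t r) < a t /\ rho_chart p a t (U t r) = r)
    by (intros t r Htr; eapply chart_coord_spec; eassumption).
  assert (HD : forall t r, Dtr a t r -> chart_range p a t r)
    by (intros t r Htr; eapply chart_range_of_Dtr; eassumption).
  assert (Hapos : forall t, 0 < t -> 0 < a t) by (apply a_pos; auto).
  assert (Pp : forall u, u <> 0 -> 0 < p u) by (eapply hubble_radius_pos; eassumption).
  assert (Hev_p : forall u, p (- u) = p u) by (intros; apply pull_even).
  assert (Hev_w : forall u, w (- u) = w u) by (intros; apply pull_even).
  assert (Hp0 : p 0 = 0) by apply pull_0.
  assert (Hpl : forall u, p u * l u = Rabs u) by (eapply hubble_radius_rate; eassumption).
  assert (Hpd : forall u, is_derive (fun u => u * p u) u (p u + w u))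
    by (eapply is_derive_id_mul_hubble_radius; eassumption).
  assert (Hadd : forall t, 0 < t -> continuity_pt (addot a) t)
    by (intros t Ht; eapply continuity_pt_of_is_derive; now apply D3).
  split.
  - exists (fun t r => gtt_t p w dVw a (adot a) (addot a) t (U t r)
      - gtt_rho p w l a (adot a) t (U t r) * rho_t p dVp a (adot a) t (U t r)),
      (fun t r => gtt_rho p w l a (adot a) t (U t r)).
    intros t r Htr. apply HD in Htr.
    destruct (chart_C1 p w l dVp dVw Cp Cw Cl Hev_w Hp0 Pp Hpl Hpd HVp HVw a (adot a) (addot a)
      Hapos D1 D2 Hadd U HU t r Htr) as (E1 & E2 & E3).
    split; [|split; now apply cont_within2_of_continuity].
    (* [gtautau] agrees with the chart expression on [chart_range], a neighbourhood of the point, so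
       the derivative carries over. *)
    apply (differentiable_pt_lim_ext (fun t r => gtt_chart p w a (adot a) t (U t r))); auto.
    generalize (chart_range_open p dVp HVp a (adot a) Hapos D1 t r Htr).
    apply locally_2d_impl, locally_2d_forall.
    intros t' r' H'. symmetry. eapply gtautau_eq; try eassumption; reflexivity.
  (* At [t0 = 0] this gives [0]. As [G] is continuous there, it is the limit value prescribed at
     [rho = rhoM]. *)
  - set (G := fun t r => areal_radius a (adot a) (addot a) (a t) (U t r) ^ 2).
    assert (CG : forall t r, Dtr a t r -> continuity_2d_pt G t r).
    { intros t r Htr. apply HD in Htr. destruct (HU t r Htr) as [Hu _].
      apply continuity_2d_pt_pow.
      apply (continuity_2d_pt_comp2 (areal_radius a (adot a) (addot a)) (fun t _ => a t) U).
      - eapply continuity_2d_pt_areal_radius; eassumption.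
      - apply continuity_2d_pt_fst, Hcont. destruct Htr; lra.
      - eapply (continuity_2d_pt_U p dVp Cp Pp HVp); eassumption. }
    exists G. split; [|split].
    + intros t r Htr Hn. unfold G, gthth, U, chart_coord. simpl Sk.
      assert (Hs : - t < t0fun a t r < t /\ r = rho_of a t (t0fun a t r))
        by (apply HD in Htr; eapply (t0fun_spec a (adot a)); eassumption).
      assert (Ea : areal_radius a (adot a) (addot a) (a t) (signed_a a (t0fun a t r)) =
        a (t0fun a t r) * chi a (Rabs (t0fun a t r)) t).
      { eapply areal_radius_chi; try eassumption. apply Rabs_def1; lra. }
      rewrite Ea. ring.
    + intros t r Htr. now apply cont_within2_of_continuity, CG.
    + intros t r th Htr _ e He.
      assert (C : continuity_2d_pt (fun x y => x * y ^ 2) (G t r) (sin th)) by cont2.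
      destruct (C (mkposreal e He)) as [d Hd]. simpl in Hd.
      destruct (CG t r Htr d) as [d1 H1].
      destruct (continuity_sin th d (cond_pos d)) as [d2 [Hd2 H2]].
      simpl in H2. unfold Rdist in H2.
      exists (Rmin d1 d2). split; [apply Rmin_glb_lt; [apply cond_pos | exact Hd2]|].
      intros t' r' th' _ Ht Hr Hth. pose proof (Rmin_l d1 d2). pose proof (Rmin_r d1 d2).
      apply Hd; [apply H1; lra|].
      destruct (Req_dec th' th) as [->|Hn]; [rewrite Rminus_diag, Rabs_R0; apply cond_pos|].
      apply H2. split; [split; [exact I | auto] | lra].
Qed.
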